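(* The set of elements $H_{a_1,\ldots,a_m|b_1,\ldots,b_n}$, where $(a_1,\ldots,a_m|b_1,\ldots,b_n)$ is canonical, forms a $K$-basis of $SS_r$ for $GL(m|n)$. In particular, each $h_{a_1,\ldots,a_m|b_1,\ldots,b_n}$ (with $0\le a_i,b_j<q$) is a summand of a unique basis element from this set. The set of such elements $H_{a_1,\ldots,a_m|b_1,\ldots,b_n}$ (with canonical indices) is a minimal set of algebra generators of $SS_r$.
   Context: $K$ is a field of characteristic $p>0$, $m,n\ge 1$, $r\ge 1$, $q=p^r$. $T$ is the diagonal torus of the general linear supergroup $GL(m|n)$ over $K$; write $x_i=e_{ii}$ ($1\le i\le m$), $y_j=e_{m+j,m+j}$ ($1\le j\le n$). $Dist(T)$, the distribution algebra of $T$, is the commutative $K$-algebra with basis $\prod_i\binom{x_i}{a_i}\prod_j\binom{y_j}{b_j}$ ($a_i,b_j\ge 0$), with multiplication obtained by tensoring with $K$ the ring of integer-valued polynomials over $\mathbb{Z}$ spanned by these products. $Dist(T_r)$ (distribution algebra of the $r$-th Frobenius kernel $T_r$ of $T$) is the subalgebra spanned by the basis monomials with all $a_i,b_j<q$. For $f\in Dist(T)$, $s_{ij}(f)$ is obtained from $f$ by replacing $x_i$ by $x_i-1$ and $y_j$ by $y_j+1$, and $\Phi_{ij}(f)=f-s_{ij}(f)$. $SS_r$ is the set of all $f\in Dist(T_r)$ that are symmetric in $x_1,\ldots,x_m$ and in $y_1,\ldots,y_n$ separately and such that for all $i,j$ there is $f'_{ij}\in Dist(T_r)$ with $\Phi_{ij}(f)=(x_i+y_j)f'_{ij}$;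 it is a subalgebra of $Dist(T_r)$. For $0\le a,b<q$ put $X_{i,a}=\sum_{k=a}^{q-1}(-1)^{k-a}\binom{k}{a}\binom{x_i}{k}$, $Y_{j,b}=\sum_{k=b}^{q-1}(-1)^{k-b}\binom{k}{b}\binom{y_j}{k}$, and $h_{a_1,\ldots,a_m|b_1,\ldots,b_n}=\prod_i X_{i,a_i}\prod_j Y_{j,b_j}$. Consider tuples $(a_1,\ldots,a_m|b_1,\ldots,b_n)$ of integers with $0\le a_i,b_j<q$. The equivalence relation $\sim$ on tuples is generated by: (i) tuples differing by an element of $\Sigma_m\times\Sigma_n$ (permuting the first $m$ and the last $n$ positions separately) are equivalent; (ii) $(a_1,a_2,\ldots,a_m|b_1,b_2,\ldots,b_n)\sim(a_1',a_2,\ldots,a_m|b_1',b_2,\ldots,b_n)$ whenever $a_1+b_1\equiv 0\pmod p$ and $a_1+b_1\equiv a_1'+b_1'\pmod q$. Define $H_{a_1,\ldots,a_m|b_1,\ldots,b_n}=\sum h_{a_1',\ldots,a_m'|b_1',\ldots,b_n'}$, the sum over all tuples $(a_1',\ldots,a_m'|b_1',\ldots,b_n')$ equivalent to $(a_1,\ldots,a_m|b_1,\ldots,b_n)$. The defect $d$ of a tuple is the maximal $d$ for which there are distinct indices $i_1,\ldots,i_d\in\{1,\ldots,m\}$ and distinct $j_1,\ldots,j_d\in\{1,\ldots,n\}$ with $a_{i_t}+b_{j_t}\equiv0\pmod p$ for all $t$. A tuple of defect $0$ is canonical if $a_1\le\cdots\le a_m$ and $b_1\le\cdots\le b_n$.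 A tuple of defect $d>0$ is canonical if there are indices $e,f$ with $d=\min\{e,f\}$, $a_1=\cdots=a_e=0$, $0<a_{e+1}\le\cdots\le a_m<p$, $b_1=\cdots=b_{f-1}=0$, $b_f$ divisible by $p$, $0<b_{f+1}\le\cdots\le b_n<p$, and $a_i+b_j\not\equiv 0\pmod p$ for $i>e$ and $j>f$.
   Formalization: ''Minimal set of algebra generators'' is taken for generation by linear combinations and products without adjoining the unit, minimal under inclusion; with the unit for free the claim fails, since the H sum to 1 and each one is 1 minus the others. *)

(* Defs.v *)
From HB Require Import structures.
From mathcomp Require Import all_boot all_order all_fingroup all_algebra.
From mathcomp Require Import finmap.
From mathcomp.multinomials Require Import monalg.

Set Implicit Arguments.
Unset Strict Implicit.
Unset Printing Implicit Defensive.

Import Order.TTheory GRing.Theory Num.Theory.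
Local Open Scope ring_scope.

(* One variable: binp a is binom(X, a) in Q[X].  The next lemmas are the      *)
(* identities of integer-valued polynomials from which the structure          *)
(* constants of the algebra dist below and the substitutions are read off.    *)
Definition binp (a : nat) : {poly rat} :=
  (a`!%:R)^-1 *: \prod_(i < a) ('X - i%:R%:P).

Lemma horner_binp (a z : nat) : (binp a).[z%:R] = 'C(z, a)%:R.
Proof.
rewrite hornerZ horner_prod.
have a0 : a`!%:R != 0 :> rat by rewrite pnatr_eq0 -lt0n fact_gt0.
apply: (mulfI a0); rewrite mulrA divff // mul1r -natrM mulnC bin_ffact.
rewrite ffact_prod natr_prod.
have [lt_za|le_az] := ltnP z a; last first.
  apply: eq_bigr => i _; rewrite hornerD hornerN hornerX hornerC.
  by rewrite natrB //; apply: leq_trans le_az; exact/ltnW.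
rewrite (bigD1 (Ordinal lt_za)) //= hornerD hornerN hornerX hornerC subrr mul0r.
by rewrite (bigD1 (Ordinal lt_za)) //= subnn mul0r.
Qed.

Lemma poly_nat_ext (P Q : {poly rat}) :
  (forall z : nat, P.[z%:R] = Q.[z%:R]) -> P = Q.
Proof.
move=> ePQ; apply/eqP; rewrite -subr_eq0; apply/negPn/negP => nz.
pose s := [seq (i%:R : rat) | i <- iota 0 (size (P - Q))].
have := max_poly_roots (rs := s) nz.
rewrite size_map size_iota ltnn => H; suff : false by [].
apply: H; last first.
  by rewrite map_inj_uniq ?iota_uniq // => i j /eqP; rewrite eqr_nat => /eqP.
by apply/allP => _ /mapP[i _ ->]; rewrite /root hornerD hornerN ePQ subrr.
Qed.

Lemma bin_mul (z a b B : nat) : (a <= B)%N ->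
  ('C(z, a) * 'C(z, b) =
     \sum_(k < B.+1) 'C(a, k) * 'C(a + b - k, a) * 'C(z, a + b - k))%N.
Proof.
move=> leaB.
have [lt_za|le_az] := ltnP z a.
  rewrite bin_small // mul0n big1 // => k _.
  have [lt_bk|le_kb] := ltnP b k.
    have [lt_ak|le_ka] := ltnP a k; first by rewrite bin_small.
    by rewrite ['C(a + b - k, a)]bin_small ?muln0 // ltn_subLR ?ltn_add2l
      ?(leq_trans le_ka) ?leq_addr // addnC ltn_add2r.
  rewrite ['C(z, _)]bin_small ?muln0 //.
  by rewrite (leq_trans lt_za) // -addnBA // leq_addr.
transitivity (\sum_(k < b.+1) 'C(z, a) * ('C(a, k) * 'C(z - a, b - k)))%N.
  by rewrite -big_distrr /= binomial.Vandermonde subnKC.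
have E (F : nat -> nat) (N M : nat) : (N <= M)%N ->
    (forall k, N < k -> F k = 0)%N ->
    (\sum_(k < M.+1) F k = \sum_(k < N.+1) F k)%N.
  move=> leNM F0; rewrite -!(big_mkord xpredT F).
  rewrite (big_cat_nat _ (n := N.+1)) //= [X in (_ + X)%N]big_nat.
  by rewrite [X in (_ + X)%N]big1 ?addn0 // => k /andP[/F0].
pose F k := ('C(a, k) * 'C(a + b - k, a) * 'C(z, a + b - k))%N.
pose G k := (if k <= b then 'C(z, a) * ('C(a, k) * 'C(z - a, b - k)) else 0)%N.
transitivity (\sum_(k < (maxn b B).+1) G k)%N.
  rewrite (E G b) ?leq_maxl //; last by move=> k; rewrite /G ltnNge; case: leqP.
  by apply: eq_bigr => -[k /= ltk] _; rewrite /G -ltnS ltk.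
rewrite -(E F B (maxn b B)) ?leq_maxr //; last first.
  by move=> k ltBk; rewrite /F bin_small ?mul0n // (leq_ltn_trans leaB).
apply: eq_bigr => -[k /= _] _; rewrite /F /G; case: leqP => [le_kb|lt_bk].
  rewrite mulnCA -mulnA; congr (_ * _)%N.
  rewrite -addnBA //; set c := (b - k)%N.
  have [le_acz|lt_zac] := leqP (a + c) z; last first.
    by rewrite ['C(z, a + c)]bin_small // muln0 ['C(z - a, c)]bin_small ?muln0
      // ltn_subLR.
  have fpos : (0 < a`! * c`! * (z - a - c)`!)%N by rewrite !muln_gt0 !fact_gt0.
  have le_cza : (c <= z - a)%N by rewrite leq_subRL.
  apply/eqP; rewrite -(eqn_pmul2r fpos); apply/eqP.
  transitivity (z`!).
    rewrite -(bin_fact le_az) -(bin_fact le_cza).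
    by rewrite -!mulnA; congr (_ * _)%N; rewrite mulnCA.
  rewrite -(bin_fact le_acz) -(bin_fact (leq_addr c a)) addKn subnDA.
  by rewrite -!mulnA mulnCA.
have [lt_ak|le_ka] := ltnP a k; first by rewrite bin_small.
rewrite ['C(a + b - k, a)]bin_small ?muln0 // ltn_subLR.
  by rewrite addnC ltn_add2r.
by rewrite (leq_trans le_ka) // leq_addr.
Qed.

Lemma binpM (a b : nat) :
  binp a * binp b =
    \sum_(k < a.+1) ('C(a, k) * 'C(a + b - k, a))%:R *: binp (a + b - k).
Proof.
apply: poly_nat_ext => z; rewrite hornerM !horner_binp -natrM.
rewrite (bin_mul z b (leqnn a)) natr_sum horner_sum; apply: eq_bigr => k _.
by rewrite hornerZ horner_binp -natrM.
Qed.

Lemma binp_predX (a : nat) :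
  binp a \Po ('X - 1) = \sum_(k < a.+1) (-1) ^+ (a - k) *: binp k.
Proof.
suff H z : (binp a \Po ('X - 1)).[z.+1%:R] =
           (\sum_(k < a.+1) (-1) ^+ (a - k) *: binp k).[z.+1%:R].
  have inj : injective (fun P : {poly rat} => P \Po ('X + 1)).
    move=> P Q /(congr1 (fun R => R \Po ('X - 1))); rewrite -!comp_polyA.
    by rewrite comp_polyD comp_polyX comp_polyC subrK !comp_polyXr.
  apply: inj; apply: poly_nat_ext => z; move: (H z).
  by rewrite [RHS]/= !horner_comp !hornerD !hornerN !hornerX !hornerC -natr1.
rewrite horner_comp hornerD hornerN hornerX hornerC -natr1 addrK horner_binp.
rewrite horner_sum natr1.
elim: a => [|a IH].
  by rewrite big_ord1 hornerZ horner_binp !bin0 mul1r.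
rewrite big_ord_recr /= subnn hornerZ horner_binp mul1r binS natrD.
rewrite (eq_bigr (fun k : 'I_a.+1 => - ((-1) ^+ (a - k) *: binp k).[z.+1%:R])).
  by rewrite sumrN -IH addrC addrK.
by move=> k _; rewrite subSn; [rewrite exprS !hornerZ mulN1r mulNr | rewrite -ltnS].
Qed.

Lemma binp_succX (a : nat) :
  binp a \Po ('X + 1) = binp a + (if a is a'.+1 then binp a' else 0).
Proof.
apply: poly_nat_ext => z; rewrite horner_comp !hornerD hornerX hornerC natr1.
rewrite !horner_binp; case: a => [|a]; first by rewrite !bin0 horner0 addr0.
by rewrite horner_binp binS natrD.
Qed.

(* dist R V is the tensor product with R of the ring of integer-valued        *)
(* polynomials in the variables v : V.  It is the free R-module on the        *)
(* multi-indices t, with << t >> standing for \prod_v binom(v, t v); the      *)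
(* structure constants of the product are those of binpM, variable by         *)
(* variable.                                                                  *)
Definition dist (R : comNzRingType) (V : finType) := {malg R[{ffun V -> nat}]}.

HB.instance Definition _ (R : comNzRingType) (V : finType) :=
  GRing.Lmodule.copy (dist R V) {malg R[{ffun V -> nat}]}.
HB.instance Definition _ (R : comNzRingType) (V : finType) :=
  Choice.copy (dist R V) {malg R[{ffun V -> nat}]}.

Section DistRing.
Variables (R : comNzRingType) (V : finType).
Local Notation idx := {ffun V -> nat}.
Local Notation D := (dist R V).
Implicit Types (f g : D) (s t : idx) (z : V -> nat).

Definition dmul_basis s t : D :=
  \sum_(k : {ffun V -> 'I_(\max_v s v).+1})
    << (\prod_v ('C(s v, k v) * 'C(s v + t v - k v, s v)))%N%:R
       *g [ffun v => (s v + t v - k v)%N] >>.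

Definition dmul f g : D :=
  \sum_(s <- msupp f) \sum_(t <- msupp g) (f@_s * g@_t) *: dmul_basis s t.

Definition dunit : D := << 1 *g [ffun=> 0%N] >>.

(* The values of an element of dist R V on natural arguments.  Evaluation is  *)
(* injective and multiplicative, whence the ring axioms.                      *)
Definition dev f z : R :=
  \sum_(t <- msupp f) f@_t * (\prod_v 'C(z v, t v))%N%:R.

Lemma devw (d : {fset idx}) f z : (msupp f `<=` d)%fset ->
  dev f z = \sum_(t <- d) f@_t * (\prod_v 'C(z v, t v))%N%:R.
Proof.
move=> le_fd; rewrite /dev (big_fset_incl _ le_fd) //= => t _ /mcoeff_outdom ->.
by rewrite mul0r.
Qed.

Lemma devZD c f g z : dev (c *: f + g) z = c * dev f z + dev g z.
Proof.
pose d := (msupp f `|` msupp g `|` msupp (c *: f + g : {malg R[idx]}))%fset.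
rewrite !(@devw d); try by rewrite /d -?fsetUA ?fsubsetUl ?fsubsetUr //;
  rewrite fsetUCA fsubsetUl.
  rewrite mulr_sumr -big_split; apply: eq_bigr => t _ /=.
  by rewrite mcoeffD mcoeffZ mulrDl mulrA.
by rewrite /d fsubsetUr.
Qed.

Lemma dev0 z : dev 0 z = 0.
Proof. by rewrite /dev msupp0 big_seq_fset0. Qed.

Lemma devZ c f z : dev (c *: f) z = c * dev f z.
Proof. by rewrite -[c *: f]addr0 devZD dev0 addr0. Qed.

Lemma devD f g z : dev (f + g) z = dev f z + dev g z.
Proof. by rewrite -[f]scale1r devZD mul1r scale1r. Qed.

Lemma dev_sum (I : Type) (r : seq I) (P : pred I) (F : I -> D) z :
  dev (\sum_(i <- r | P i) F i) z = \sum_(i <- r | P i) dev (F i) z.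
Proof. by apply: (big_morph (dev^~ z)) => [f g|]; rewrite ?devD ?dev0. Qed.

Lemma devU c t z : dev << c *g t >> z = c * (\prod_v 'C(z v, t v))%N%:R.
Proof. by rewrite (devw _ msuppU_le) big_seq_fset1 mcoeffUU. Qed.

Lemma dev_inj f g : dev f =1 dev g -> f = g.
Proof.
suff H h : dev h =1 (fun=> 0) -> h = 0 => [efg|].
  apply/eqP; rewrite -subr_eq0; apply/eqP/H => z.
  by rewrite addrC -scaleN1r devZD mulN1r efg addNr.
move=> h0; apply/malgP => t; rewrite mcoeff0.
have [N] := ubnP (\sum_v t v); elim: N => // N IH in t *; rewrite ltnS => leN.
have := h0 t; rewrite (devw _ (fsubsetUr [fset t]%fset _)).
rewrite (big_fsetD1 t) /=; last by rewrite !inE eqxx.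
rewrite [X in X%:R]big1 ?mulr1 => [|v _]; last exact: binn.
rewrite big_seq big1 ?addr0 // => s; rewrite !inE => /andP[nst _].
have [/forallP le_st|] := boolP [forall v, s v <= t v]%N; last first.
  rewrite negb_forall => /existsP[v]; rewrite -ltnNge => lt_ts.
  by rewrite (bigD1 v) //= bin_small // mul0n mulr0.
rewrite IH ?mul0r //; apply: leq_trans leN.
have /existsP[v nv] : [exists v, s v != t v].
  rewrite -negb_forall; apply: contra nst => /forallP E.
  by apply/eqP/ffunP => v; exact/eqP/E.
rewrite (bigD1 v) // [X in (_ < X)%N](bigD1 v) //= -addSn leq_add //.
  by rewrite ltn_neqAle nv le_st.
exact: leq_sum.
Qed.

Lemma dev_mul_basis s t z :
  dev (dmul_basis s t) z =
    (\prod_v 'C(z v, s v))%N%:R * (\prod_v 'C(z v, t v))%N%:R.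
Proof.
rewrite -natrM -big_split dev_sum.
rewrite (eq_bigr _ (fun k _ => devU _ _ z)).
rewrite (eq_bigr _ (fun k _ => esym (natrM _ _ _))) -natr_sum; congr _%:R.
rewrite [RHS](eq_bigr _ (fun v _ => bin_mul (z v) (t v) (@leq_bigmax _ s v))).
rewrite bigA_distr_bigA; apply: eq_bigr => k _; rewrite -big_split /=.
by apply: eq_bigr => v _; rewrite ffunE.
Qed.

Lemma dev_mul f g z : dev (dmul f g) z = dev f z * dev g z.
Proof.
rewrite /dmul dev_sum [X in X * _]/dev mulr_suml; apply: eq_bigr => s _.
rewrite dev_sum [dev g z]/dev mulr_sumr; apply: eq_bigr => t _.
by rewrite devZ dev_mul_basis mulrACA.
Qed.

Lemma dev_one z : dev dunit z = 1.
Proof.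
rewrite devU mul1r big1 // => v _; by rewrite ffunE bin0.
Qed.

Let dE := (dev_mul, dev_one, devD).

Fact dmulA : associative dmul.
Proof. by move=> f g h; apply: dev_inj => z; rewrite !dE mulrA. Qed.
Fact dmulC : commutative dmul.
Proof. by move=> f g; apply: dev_inj => z; rewrite !dE mulrC. Qed.
Fact dmul1f : left_id dunit dmul.
Proof. by move=> f; apply: dev_inj => z; rewrite !dE mul1r. Qed.
Fact dmulDl : left_distributive dmul +%R.
Proof. by move=> f g h; apply: dev_inj => z; rewrite !dE mulrDl. Qed.
Fact dunit_neq0 : dunit != 0.
Proof. by rewrite monalgU_eq0 oner_eq0. Qed.

HB.instance Definition _ := GRing.Zmodule_isComNzRing.Build D
  dmulA dmulC dmul1f dmulDl dunit_neq0.

Fact dscaleAl c f g : c *: (f * g) = (c *: f) * g.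
Proof.
by apply: dev_inj => z; rewrite devZ [f * g]/(dmul f g)
  [X in dev X]/(dmul _ g) !dev_mul devZ mulrA.
Qed.

HB.instance Definition _ := GRing.Lmodule_isLalgebra.Build R D dscaleAl.
HB.instance Definition _ := GRing.Lalgebra_isComAlgebra.Build R D.

Lemma devM f g z : dev (f * g) z = dev f z * dev g z.
Proof. exact: dev_mul. Qed.

Lemma dev1 z : dev 1 z = 1.
Proof. exact: dev_one. Qed.

(* binom(v, a) *)
Definition dbin (v : V) (a : nat) : D := << [ffun w => if w == v then a else 0%N] >>.

Lemma dbasisE t : << t >> = \prod_v dbin v (t v) :> D.
Proof.
apply: dev_inj => z; rewrite (big_morph (dev^~ z) (fun f g => devM f g z) (dev1 z)) devU.
rewrite mul1r natr_prod; apply: eq_bigr => v _.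
rewrite devU mul1r (bigD1 v) //= ffunE eqxx big1 ?muln1 // => w /negPf nwv.
by rewrite ffunE nwv bin0.
Qed.

Definition dlin (F : idx -> D) f : D := \sum_(t <- msupp f) f@_t *: F t.

(* binom(v - 1, a) and binom(v + 1, a); see binp_predX and binp_succX *)
Definition dbin_pred (v : V) (a : nat) : D :=
  \sum_(k < a.+1) (-1) ^+ (a - k) *: dbin v k.
Definition dbin_succ (v : V) (a : nat) : D :=
  dbin v a + (if a is a'.+1 then dbin v a' else 0).

End DistRing.

Section Supersymmetric.
Variables (K : fieldType) (p r m n : nat).

(* inl i is the variable x_i, inr j the variable y_j *)
Local Notation var := ('I_m + 'I_n)%type.
Local Notation D := (dist K var).
Implicit Types (f : D) (i : 'I_m) (j : 'I_n).

Definition distTr f : Prop :=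
  forall t, t \in msupp f -> forall v, (t v < p ^ r)%N.

Definition perm_var (s : 'S_m) (u : 'S_n) (v : var) : var :=
  match v with inl i => inl (s i) | inr j => inr (u j) end.

Definition perm_subst (s : 'S_m) (u : 'S_n) : D -> D :=
  dlin (fun t => \prod_v dbin K (perm_var s u v) (t v)).

Definition symmetric f : Prop := forall s u, perm_subst s u f = f.

Definition shift i j : D -> D :=
  dlin (fun t => \prod_(v : var)
    if v == inl i then dbin_pred K v (t v)
    else if v == inr j then dbin_succ K v (t v)
    else dbin K v (t v)).

Definition Phi i j f : D := f - shift i j f.

Definition SS f : Prop :=
  [/\ distTr f, symmetric f &
      forall i j, exists2 f', distTr f' &
        Phi i j f = (dbin K (inl i) 1 + dbin K (inr j) 1) * f'].

Definition XY (v : var) (a : nat) : D :=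
  \sum_(a <= k < p ^ r) ((-1) ^+ (k - a) * 'C(k, a)%:R) *: dbin K v k.

Definition tup := {ffun var -> 'I_(p ^ r)}.
Implicit Types t u c : tup.

Definition hel t : D :=
  (\prod_i XY (inl i) (t (inl i))) * (\prod_j XY (inr j) (t (inr j))).

Definition perm_step t u : bool :=
  [exists s : 'S_m, exists w : 'S_n, u == [ffun v => t (perm_var s w v)]].

Definition shift_step t u : bool :=
  [exists i : 'I_m, exists j : 'I_n,
    [&& i == 0%N :> nat, j == 0%N :> nat,
        p %| t (inl i) + t (inr j),
        t (inl i) + t (inr j) == u (inl i) + u (inr j) %[mod p ^ r] &
        [forall v, (v != inl i) ==> (v != inr j) ==> (u v == t v)]]]%N.

Definition tup_equiv : rel tup :=
  connect (fun t u =>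
    [|| perm_step t u, perm_step u t, shift_step t u | shift_step u t]).

Definition Hel c : D := \sum_(t | tup_equiv c t) hel t.

Definition matching t (d : nat) : bool :=
  [exists f : {ffun 'I_d -> 'I_m}, exists g : {ffun 'I_d -> 'I_n},
    [&& injectiveb f, injectiveb g &
        [forall k, p %| t (inl (f k)) + t (inr (g k))]]]%N.

Definition defect t : nat := \max_(d < m.+1 | matching t d) d.

Definition canonical0 t : bool :=
  [forall i : 'I_m, forall i' : 'I_m, (i <= i') ==> (t (inl i) <= t (inl i'))]%N &&
  [forall j : 'I_n, forall j' : 'I_n, (j <= j') ==> (t (inr j) <= t (inr j'))]%N.

(* Ordinals start at 0: a_k is t (inl i) with k = i.+1, and similarly for b.  *)
Definition canonical_pos t (e f : nat) : bool :=
  [&& [forall i : 'I_m, (i.+1 <= e) ==> (t (inl i) == 0 :> nat)],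
      [forall i : 'I_m, (e < i.+1) ==> (0 < t (inl i) < p)],
      [forall i : 'I_m, forall i' : 'I_m,
         (e < i.+1) ==> (i <= i') ==> (t (inl i) <= t (inl i'))],
      [forall j : 'I_n, (j.+1 < f) ==> (t (inr j) == 0 :> nat)],
      [forall j : 'I_n, (j.+1 == f) ==> (p %| t (inr j))],
      [forall j : 'I_n, (f < j.+1) ==> (0 < t (inr j) < p)],
      [forall j : 'I_n, forall j' : 'I_n,
         (f < j.+1) ==> (j <= j') ==> (t (inr j) <= t (inr j'))] &
      [forall i : 'I_m, forall j : 'I_n,
         (e < i.+1) ==> (f < j.+1) ==> ~~ (p %| t (inl i) + t (inr j))]]%N.

Definition canonical t : bool :=
  if defect t == 0%N then canonical0 t
  else [exists e : 'I_m.+1, exists f : 'I_n.+1,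
          (defect t == minn e f) && canonical_pos t e f].

End Supersymmetric.

Definition is_basis (K : fieldType) (V : lmodType K) (I : finType) (P : pred I)
    (F : I -> V) (S : V -> Prop) : Prop :=
  (forall w : I -> K,
     \sum_(i | P i) w i *: F i = 0 -> forall i, P i -> w i = 0) /\
  (forall v, S v <-> exists w : I -> K, v = \sum_(i | P i) w i *: F i).

Section Generation.
Variables (K : fieldType) (A : comAlgType K).
Implicit Types (S B : A -> Prop).

(* Subalgebras are not required to contain the unit.  A complete family of    *)
(* orthogonal idempotents sums to 1, so each of its members would be          *)
(* redundant if 1 came for free.                                              *)
Definition subalg B : Prop :=
  [/\ B 0, forall (a : K) x y, B x -> B y -> B (a *: x + y) &
      forall x y, B x -> B y -> B (x * y)].

Definition generated S (x : A) : Prop :=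
  forall B, subalg B -> (forall y, S y -> B y) -> B x.

Definition generates S B : Prop := forall x, generated S x <-> B x.

Definition minimal_generators S B : Prop :=
  generates S B /\
  forall S', (forall x, S' x -> S x) -> generates S' B ->
    forall x, S x -> S' x.

End Generation.

(* Main.v *)
Require Import Defs.
From HB Require Import structures.
From mathcomp Require Import all_boot all_order all_fingroup all_algebra.
From mathcomp Require Import finmap.
From mathcomp.multinomials Require Import monalg.
From mathcomp Require Import zify ring.

Set Implicit Arguments.
Unset Strict Implicit.
Unset Printing Implicit Defensive.

Import GRing.Theory.
Local Open Scope ring_scope.

(** An element of Dist(T) is determined by its values on natural arguments,
    and binom(x, a) with a < q takes q-periodic values in characteristic p.  So
    Dist(T_r) is the algebra of all functions (Z/q)^(m+n) -> K, in which
    [hel t] is the indicator of the point t ([dev_hel], [distTrP]).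

    At a point z with z_i + z_j not divisible by p the factor x_i + y_j is
    invertible, and elsewhere it vanishes.  Hence x_i + y_j divides Phi_ij(f)
    exactly when f(z) = f(z - e_i + e_j) at every z with p | z_i + z_j.  Such
    steps keep z_i + z_j, and they reach every pair with the same sum modulo q;
    together with symmetry this says that SS_r consists of the functions that
    are constant on the classes of ~ ([SSP]).  The elements H are the
    indicators of the classes, so all the claims reduce to one combinatorial
    fact: every class contains exactly one canonical tuple.

    Existence ([canonical_exists]).  In a class without entries such that
    p | a_i + b_j one sorts.  Otherwise fix a pair (i0, j0) with
    p | a_i0 + b_j0.  It acts as a hub: it can be moved to residues (x, -x)
    for any x, so that any other entry comes to form a divisible pair with one
    of its two entries, and the part of that entry divisible by p can be
    absorbed by b_j0.  A representative of least weight has all entries other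
    than b_j0 in [0, p), b_j0 divisible by p, and no divisible pair of nonzero
    residues; sorting makes it canonical.

    Uniqueness ([canonical_unique]).  For each x the difference between the
    number of a_i = x and the number of b_j = -x modulo p is invariant, as is
    the sum of all entries modulo q.  In a canonical tuple of positive defect
    one of the two numbers is 0 for every x prime to p, so the difference
    determines both; this gives all the residues, and the sum gives the only
    entry b_f that is not already a residue.

    The H of distinct classes are orthogonal idempotents.  Those vanishing on
    a given class span a subalgebra without the H of that class, whence
    minimality of the generating set. *)

(** * Binomial coefficients modulo p *)

Section BinomialCoefficients.
Variables (K : fieldType) (p r : nat).
Hypothesis pK : p \in [pchar K].

(** Since k C(q, k) = q C(q - 1, k - 1), if p did not divide C(q, k) then q
    would divide k. *)
Lemma dvdn_bin_expn_prime k :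
  (0 < k < p ^ r)%N -> (p %| 'C(p ^ r, k))%N.
Proof.
have pp := pcharf_prime pK.
case: k => // k /= ltk; apply/negPn/negP => npC.
suff : (p ^ r %| k.+1)%N by move/dvdn_leq => /(_ isT); rewrite leqNgt ltk.
rewrite -(@Gauss_dvdl _ _ 'C(p ^ r, k.+1)) ?coprimeXl ?prime_coprime //.
by rewrite -mul_bin_diag dvdn_mulr.
Qed.

(** Vandermonde's convolution: all terms C(q, k) C(z, a - k) but the one with
    k = 0 vanish. *)
Lemma bin_addq a z : (a < p ^ r)%N ->
  'C(z + p ^ r, a)%:R = 'C(z, a)%:R :> K.
Proof.
move=> lta; rewrite addnC -binomial.Vandermonde natr_sum big_ord_recl /=.
rewrite bin0 mul1n subn0 big1 ?addr0 // => i _.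
rewrite natrM; suff /eqP-> : 'C(p ^ r, bump 0 i)%:R == 0 :> K by rewrite mul0r.
rewrite -(dvdn_pcharf pK) dvdn_bin_expn_prime //= /bump /= add1n.
exact: leq_ltn_trans (ltn_ord i) lta.
Qed.

Lemma bin_modq a z : (a < p ^ r)%N ->
  'C(z %% p ^ r, a)%:R = 'C(z, a)%:R :> K.
Proof.
move=> lta; rewrite [in RHS](divn_eq z (p ^ r)).
elim: (z %/ _)%N => [|k IH]; first by rewrite mul0n.
by rewrite mulSn -addnA addnC bin_addq.
Qed.

Lemma natr_modq z : (0 < r)%N -> (z %% p ^ r)%:R = z%:R :> K.
Proof.
move=> r_gt0; rewrite [in RHS](divn_eq z (p ^ r)) natrD natrM natrX.
by rewrite (pcharf0 pK) expr0n gtn_eqF // mulr0 add0r.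
Qed.

(** C(k, a) C(z, k) = C(z, a) C(z - a, k - a) turns the sum into the binomial
    expansion of C(z, a) (1 - 1)^(z - a).  This is what makes X_(i,a) and
    Y_(j,b) indicators of residues. *)
Lemma bin_inversion a z : (a < p ^ r)%N -> (z < p ^ r)%N ->
  \sum_(a <= k < p ^ r) (-1) ^+ (k - a) * 'C(k, a)%:R * 'C(z, k)%:R
    = (z == a)%:R :> K.
Proof.
move=> lta ltz.
have E k : 'C(k, a)%:R * 'C(z, k)%:R =
           (if (a <= k)%N then 'C(z, a)%:R * 'C(z - a, k - a)%:R else 0) :> K.
  have [le_ak|lt_ka] := leqP a k; last by rewrite (bin_small lt_ka) mul0r.
  rewrite -!natrM; congr (_%:R).
  have [le_kz|lt_zk] := leqP k z; last first.
    rewrite (bin_small lt_zk) muln0; have [lt_za|le_az] := ltnP z a.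
      by rewrite bin_small.
    by rewrite (@bin_small (z - a)) ?muln0 // ltn_sub2r // (leq_ltn_trans le_az).
  have fpos : (0 < a`! * (k - a)`! * (z - k)`!)%N by rewrite !muln_gt0 !fact_gt0.
  apply/eqP; rewrite -(eqn_pmul2r fpos); apply/eqP.
  transitivity (z`!).
    by rewrite -(bin_fact le_kz) -(bin_fact le_ak); ring.
  have le_az : (a <= z)%N by lia.
  have le_s : (k - a <= z - a)%N by lia.
  rewrite -(bin_fact le_az) -(bin_fact le_s).
  have -> : (z - a - (k - a) = z - k)%N by lia.
  ring.
have [lt_za|le_az] := ltnP z a.
  rewrite (ltn_eqF lt_za) big1_seq // => k _.
  by rewrite -mulrA E (bin_small lt_za) mul0r; case: ifP; rewrite mulr0.
pose d := (z - a)%N.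
transitivity ('C(z, a)%:R * (1 - 1) ^+ d : K); last first.
  rewrite subrr expr0n /d subn_eq0; have [->|ne] := eqVneq z a.
    by rewrite leqnn binn mulr1.
  by rewrite leqNgt ltn_neqAle eq_sym ne le_az mulr0.
rewrite -[in LHS](add0n a) big_addn big_mkord exprDn mulr_sumr.
have -> : (p ^ r - a = d.+1 + (p ^ r - z.+1))%N by rewrite /d; lia.
rewrite big_split_ord /= [X in _ + X]big1 ?addr0 => [|k _]; last first.
  rewrite -mulrA E ifT; last by lia.
  by rewrite (@bin_small (z - a)) ?mulr0 //; rewrite /d; lia.
apply: eq_bigr => k _; rewrite -mulrA E ifT; last by lia.
by rewrite addnK expr1n mul1r mulrCA mulr_natr.
Qed.

End BinomialCoefficients.

(** * Nondecreasing families of natural numbers *)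

Section SortedFamilies.
Variable k : nat.
Implicit Types (a b : 'I_k -> nat).

Definition nondecreasing_ord a := forall i i' : 'I_k, (i <= i')%N -> (a i <= a i')%N.

Lemma nondecreasing_sorted a : nondecreasing_ord a -> sorted leq (codom a).
Proof.
move=> mona; rewrite codomE sorted_map.
apply: (sub_sorted mona); have := iota_sorted 0 k.
by rewrite -val_enum_ord sorted_map.
Qed.

(** Counts of the positive values suffice, as the number of zeros is what
    remains of the k indices.  This form suits canonical tuples, where the
    invariants of a class give the counts of nonzero residues only. *)
Lemma nondecreasing_ord_eq a b :
    nondecreasing_ord a -> nondecreasing_ord b ->
    (forall x, (0 < x)%N -> #|[pred i | a i == x]| = #|[pred i | b i == x]|) ->
  a =1 b.
Proof.
move=> mona monb eqn.
have cE c x : count_mem x (codom c) = #|[pred i : 'I_k | c i == x]|.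
  by rewrite codomE count_map cardE size_filter enumT.
(* Split off the zeros: the positive parts agree by hypothesis. *)
pose nz := predC1 0%N.
have pnz : perm_eq (filter nz (codom a)) (filter nz (codom b)).
  apply/allP => x _ /=; rewrite !count_filter; apply/eqP.
  have [->|x_gt0] := posnP x; first by rewrite !(@eq_count _ _ pred0) ?count_pred0 //; case.
  have E s : count (predI (pred1 x) nz) s = count_mem x s.
    by apply: eq_count => y /=; case: eqP => // ->; rewrite -lt0n.
  by rewrite !E !cE eqn.
have pab : perm_eq (codom a) (codom b).
  apply/allP => x _ /=; have [->|x_gt0] := posnP x; last by rewrite !cE eqn.
  move/perm_size: pnz; rewrite !size_filter => enz.
  have := count_predC (pred1 0%N) (codom a).
  rewrite size_codom -(size_codom b) -(count_predC (pred1 0%N) (codom b)) enz.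
  by move/addIn => ->.
have eab : codom a = codom b.
  apply: (sorted_eq leq_trans anti_leq) => //; exact: nondecreasing_sorted.
move=> i; move: eab; rewrite !codomE => /eq_in_map; apply.
by rewrite mem_enum.
Qed.

Lemma card_preim_perm (s : 'S_k) (P : pred 'I_k) : #|[pred i | P (s i)]| = #|P|.
Proof. by rewrite -!sum1_card [RHS](reindex_inj (@perm_inj _ s)). Qed.

Lemma exists_sorting a : exists s : 'S_k, nondecreasing_ord (fun i => a (s i)).
Proof.
pose t := [tuple a i | i < k].
have /tuple_permP[s es] : perm_eq (sort leq t) t by rewrite perm_sort.
exists s => i i' lei.
have := sorted_leq_nth leq_trans leqnn 0%N (sort_sorted leq_total t).
move=> /(_ i i'); rewrite !inE es size_tuple !ltn_ord => /(_ isT isT lei).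
by rewrite !nth_mktuple !tnth_mktuple.
Qed.

Lemma exists_threshold (P : pred 'I_k) :
    (forall i i' : 'I_k, (i <= i')%N -> P i' -> P i) ->
  exists e : 'I_k.+1, forall i, P i = (i < e)%N.
Proof.
move=> downP.
(* The least e from which P fails; such an e exists as k qualifies. *)
pose A e := [forall i : 'I_k, (e <= i)%N ==> ~~ P i].
have exA : exists e, A e.
  by exists k; apply/forallP => i; rewrite leqNgt ltn_ord.
case: (ex_minnP exA) => e /forallP Ae mine.
have lek : (e < k.+1)%N.
  by rewrite ltnS mine //; apply/forallP => i; rewrite leqNgt ltn_ord.
exists (Ordinal lek) => i /=; apply/idP/idP => [Pi|].
  by rewrite ltnNge; apply/negP => lei; have := Ae i; rewrite lei Pi.
apply: contraLR => nPi; rewrite -leqNgt; apply: mine.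
apply/forallP => i'; apply/implyP => lei; apply: contra nPi; exact: downP.
Qed.

End SortedFamilies.

(** * The classes of tuples *)

Section Classes.
Variables (p r m n : nat).
Hypotheses (p_pr : prime p) (r_gt0 : (0 < r)%N).
Local Notation var := ('I_m + 'I_n)%type.
Local Notation q := (p ^ r)%N.
Local Notation tup := (tup p r m n).
Implicit Types (i : 'I_m) (j : 'I_n) (t u c : tup) (z : var -> nat).

Lemma modulus_gt0 : (0 < q)%N.
Proof. by rewrite expn_gt0 prime_gt0. Qed.

Lemma leq_prime_modulus : (p <= q)%N.
Proof. by rewrite -[leqLHS]expn1 leq_pexp2l // prime_gt0. Qed.

Lemma eq_modq_modp a b : a = b %[mod q] -> a = b %[mod p].
Proof.
by move=> /(congr1 (modn^~ p)); rewrite !modn_dvdm // dvdn_exp.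
Qed.

Lemma dvdn_modq a b : a = b %[mod q] -> (p %| a)%N = (p %| b)%N.
Proof. by move/eq_modq_modp => eab; rewrite /dvdn eab. Qed.

(** The point of (Z/q)^(m+n) below a family of natural arguments. *)
Definition residues z : tup := [ffun v => Ordinal (ltn_pmod (z v) modulus_gt0)].

Lemma residues_tup t : residues (fun v => t v) = t.
Proof. by apply/ffunP => v; apply/val_inj; rewrite ffunE /= modn_small. Qed.

Lemma eq_residues z z' : (forall v, z v = z' v %[mod q]) -> residues z = residues z'.
Proof. by move=> ez; apply/ffunP => v; apply/val_inj; rewrite !ffunE /= ez. Qed.

Lemma tup_equiv_sym t u : tup_equiv t u = tup_equiv u t.
Proof.
by apply: sym_connect_sym => x y; apply/or4P/or4P => -[] ->;
  by [apply: Or41 | apply: Or42 | apply: Or43 | apply: Or44].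
Qed.

Lemma tup_equiv_trans t u c : tup_equiv t u -> tup_equiv u c -> tup_equiv t c.
Proof. exact: connect_trans. Qed.

(** The induction principle behind all invariants of a class: the generating
    relation is symmetrized, so the steps need to be checked in one direction
    only. *)
Lemma tup_equiv_eq (A : Type) (F : tup -> A) :
  (forall t u, perm_step t u -> F t = F u) ->
  (forall t u, shift_step t u -> F t = F u) ->
  forall t u, tup_equiv t u -> F t = F u.
Proof.
move=> Fp Fs t u /connectP[s + ->]; elim: s t => //= t' s IH t /andP[tt' /IH <-].
by case/or4P: tt' => [/Fp|/Fp|/Fs|/Fs].
Qed.

Definition tup_perm (s : 'S_m) (w : 'S_n) t : tup := [ffun v => t (perm_var s w v)].

Lemma tup_equiv_perm s w t : tup_equiv t (tup_perm s w t).
Proof.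
apply: connect1; apply/or4P; apply: Or41; apply/existsP; exists s.
by apply/existsP; exists w.
Qed.

(** The shift is generated on the first positions only; transpositions carry
    it to any pair of positions. *)
Lemma tup_equiv_shift i j t u :
  (p %| t (inl i) + t (inr j))%N ->
  t (inl i) + t (inr j) = u (inl i) + u (inr j) %[mod q] ->
  (forall v, v != inl i -> v != inr j -> u v = t v) ->
  tup_equiv t u.
Proof.
move=> ptij etu off.
pose i0 : 'I_m := Ordinal (leq_ltn_trans (leq0n i) (ltn_ord i)).
pose j0 : 'I_n := Ordinal (leq_ltn_trans (leq0n j) (ltn_ord j)).
pose s := tperm i0 i; pose w := tperm j0 j.
apply: (tup_equiv_trans (tup_equiv_perm s w t)).
rewrite tup_equiv_sym; apply: (tup_equiv_trans (tup_equiv_perm s w u)).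
apply: connect1; apply/or4P; apply: Or44; apply/existsP; exists i0.
apply/existsP; exists j0; rewrite !ffunE /= !tpermL ptij etu !eqxx /=.
apply/forallP => v; apply/implyP => nvi; apply/implyP => nvj; rewrite !ffunE.
rewrite off //.
  case: v {nvj} nvi => [i'|//] /=; apply: contra => /eqP[]/(canRL (tpermK _ _)).
  by rewrite tpermR => ->.
case: v {nvi} nvj => [//|j'] /=; apply: contra => /eqP[]/(canRL (tpermK _ _)).
by rewrite tpermR => ->.
Qed.

(** The tuples of positive defect, see [defect_eq0]. *)
Definition atypical t : bool :=
  [exists i : 'I_m, [exists j : 'I_n, p %| t (inl i) + t (inr j)]]%N.

Lemma atypicalP t :
  reflect (exists i j, (p %| t (inl i) + t (inr j))%N) (atypical t).
Proof.
apply: (iffP existsP) => [[i /existsP[j pij]]|[i [j pij]]]; first by exists i, j.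
by exists i; apply/existsP; exists j.
Qed.

Lemma matching_atypical t d : matching t d.+1 -> atypical t.
Proof.
move=> /existsP[f /existsP[g /and3P[_ _ /forallP fg]]].
by apply/atypicalP; exists (f ord0), (g ord0).
Qed.

Lemma defect_eq0 t : (defect t == 0%N) = ~~ atypical t.
Proof.
apply/eqP/idP => [d0|np]; last first.
  apply/eqP; rewrite -leqn0; apply/bigmax_leqP => -[[|d] ltd] //= md.
  by rewrite (matching_atypical md) in np.
apply/negP => /atypicalP[i [j pij]].
have m_gt0 : (1 < m.+1)%N by rewrite ltnS (leq_ltn_trans _ (ltn_ord i)).
have inj1 (T : eqType) (x : T) : injectiveb [ffun _ : 'I_1 => x].
  by apply/injectiveP => a b _; rewrite !ord1.
have : matching t 1.
  apply/existsP; exists [ffun=> i]; apply/existsP; exists [ffun=> j].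
  by rewrite !inj1; apply/forallP => a; rewrite !ffunE.
move=> m1; rewrite /defect in d0.
have := @leq_bigmax_cond _ (fun d : 'I_m.+1 => matching t d) (fun d => d)
  (Ordinal m_gt0) m1.
by rewrite d0.
Qed.

Lemma tup_perm_comp s w s' w' t :
  tup_perm s w (tup_perm s' w' t) = tup_perm (s * s') (w * w') t.
Proof. by apply/ffunP => -[v|v]; rewrite !ffunE /= permM. Qed.

Lemma perm_stepP t u : reflect (exists s w, u = tup_perm s w t) (perm_step t u).
Proof.
apply: (iffP existsP) => [[s /existsP[w /eqP]]|[s [w e]]]; first by exists s, w.
by exists s; apply/existsP; exists w; apply/eqP.
Qed.

Lemma shift_stepP t u : shift_step t u ->
  exists i j, [/\ (p %| t (inl i) + t (inr j))%N,
    t (inl i) + t (inr j) = u (inl i) + u (inr j) %[mod q] &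
    forall v, v != inl i -> v != inr j -> u v = t v].
Proof.
move=> /existsP[i /existsP[j /and5P[_ _ ptij /eqP etu /forallP off]]].
exists i, j; split=> // v nvi nvj.
by have := off v; rewrite nvi nvj => /eqP.
Qed.

Lemma shift_step_atypical t u : shift_step t u -> atypical t /\ atypical u.
Proof.
move=> /shift_stepP[i [j [ptij etu _]]].
by split; apply/atypicalP; exists i, j; rewrite // -(dvdn_modq etu).
Qed.

Lemma atypical_perm s w t : atypical (tup_perm s w t) = atypical t.
Proof.
have H s' w' t' : atypical (tup_perm s' w' t') -> atypical t'.
  move=> /atypicalP[i [j]]; rewrite !ffunE => pij.
  by apply/atypicalP; exists (s' i), (w' j).
apply/idP/idP; first exact: H.
rewrite -{1}[t](_ : tup_perm s^-1 w^-1 (tup_perm s w t) = t); first exact: H.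
by rewrite tup_perm_comp !mulVg; apply/ffunP => -[v|v]; rewrite ffunE /= perm1.
Qed.

Lemma atypical_equiv t u : tup_equiv t u -> atypical t = atypical u.
Proof.
apply: tup_equiv_eq => {}t {}u; last by move/shift_step_atypical => [-> ->].
by move=> /perm_stepP[s [w ->]]; rewrite atypical_perm.
Qed.

(** Both ends of a shift are atypical, so permutations are the only steps
    within a typical class. *)
Lemma equiv_typical t u :
  ~~ atypical t -> tup_equiv t u -> exists s w, u = tup_perm s w t.
Proof.
move=> npt etu.
have np v : perm_step t v -> ~~ atypical v.
  by move=> /perm_stepP[s [w ->]]; rewrite atypical_perm.
apply/perm_stepP; rewrite -(tup_equiv_eq (F := fun v => perm_step t v) _ _ etu).
- by apply/perm_stepP; exists 1%g, 1%g; apply/ffunP => -[v|v]; rewrite ffunE /= perm1.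
- move=> x y /perm_stepP[s [w ->]]; apply/perm_stepP/perm_stepP => -[s' [w' e]].
    by exists (s * s')%g, (w * w')%g; rewrite e tup_perm_comp.
  exists (s^-1 * s')%g, (w^-1 * w')%g; rewrite -tup_perm_comp -e tup_perm_comp !mulVg.
  by apply/ffunP => -[v|v]; rewrite ffunE /= perm1.
- move=> x y /shift_step_atypical[px py].
  by apply/idP/idP => /np; rewrite ?px ?py.
Qed.

(** Reduced modulo p the right entries are nondecreasing too, because the
    exceptional entry b_f becomes one of the initial zeros. *)
Lemma canonical_pos_shape c e f : canonical_pos c e f ->
  [/\ forall i, c (inl i) < p,
      nondecreasing_ord (fun i => c (inl i)),
      forall j, (c (inr j) %% p == 0) = (j < f),
      nondecreasing_ord (fun j => c (inr j) %% p)%N &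
      forall j, j.+1 != f -> c (inr j) < p]%N /\
  (forall i j, (0 < c (inl i))%N -> ~~ (p %| c (inr j))%N ->
     ~~ (p %| c (inl i) + c (inr j))%N).
Proof.
case/and5P => /forallP a0 /forallP ap /forallP amon /forallP b0.
case/and4P => /forallP bf /forallP bp /forallP bmon /forallP ab.
have p_gt0 := prime_gt0 p_pr.
have aE i : if (i < e)%N then c (inl i) = 0%N :> nat else (0 < c (inl i) < p)%N.
  by have := a0 i; have := ap i; rewrite ltnS; case: (ltnP i e) => // _ _ /eqP.
have bE j : if (j < f)%N then (c (inr j) %% p = 0)%N
            else (0 < c (inr j) < p)%N.
  case: (ltngtP j.+1 f) => [ltjf|ltfj|ejf].
  - by have := b0 j; rewrite ltjf => /eqP->; rewrite mod0n.
  - by have := bp j; rewrite ltfj.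
  - by have := bf j; rewrite ejf eqxx => /eqP.
have bmod j : (c (inr j) %% p == 0)%N = (j < f)%N.
  have := bE j; case: (ltnP j f) => _ => [->//|/andP[b_gt0 ltb]].
  by rewrite modn_small // gtn_eqF.
split; first split=> // [i|i i' lei|j j' lej|j].
- by have := aE i; case: (ltnP i e) => _ => [->//|/andP[]].
- have [ltie|leei] := ltnP i e; first by have := aE i; rewrite ltie => ->.
  by have := amon i => /forallP/(_ i'); rewrite ltnS leei lei.
- have [ltjf|lefj] := ltnP j f; first by have := bE j; rewrite ltjf => ->.
  have lefj' := leq_trans lefj lej.
  have := bE j; have := bE j'; rewrite !(ltnNge _ f) lefj lefj' /=.
  move=> /andP[_ ltb'] /andP[_ ltb]; rewrite !modn_small //.
  by have := bmon j => /forallP/(_ j'); rewrite ltnS lefj lej.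
- case: (ltngtP j.+1 f) => [ltjf|ltfj|] // _.
    by have := b0 j; rewrite ltjf => /eqP->.
  by have := bp j; rewrite ltfj => /andP[].
move=> i j a_gt0 nb; have := ab i => /forallP/(_ j); rewrite !ltnS.
have := aE i; case: (ltnP i e) => _ => [a_0|_]; first by rewrite a_0 in a_gt0.
by rewrite leqNgt -bmod nb.
Qed.

(** A divisible pair has both or none of its entries divisible by p, and the
    latter is excluded by canonicity; so a matching lives in the first e left
    and the first f right positions. *)
Lemma defect_canonical_pos c (e : 'I_m.+1) (f : 'I_n.+1) :
  canonical_pos c e f -> defect c = minn e f.
Proof.
move=> can; have [[ltap _ bmod _ _] nab] := canonical_pos_shape can.
have aE i : (p %| c (inl i))%N = (i < e)%N.
  case/and5P: can => /forallP/(_ i) a0 /forallP/(_ i) ap _ _ _.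
  move: a0 ap; rewrite ltnS; case: (ltnP i e) => _ => [/eqP-> _|_ /andP[a_gt0 _]].
    exact: dvdn0.
  by rewrite /dvdn modn_small // gtn_eqF.
have bE j : (p %| c (inr j))%N = (j < f)%N by rewrite -bmod.
have abE i j : (p %| c (inl i) + c (inr j))%N -> (i < e)%N = (j < f)%N.
  move=> pab; rewrite -aE -bE.
  by apply/idP/idP => pc; [rewrite -(dvdn_addr _ pc) | rewrite -(dvdn_addl _ pc)].
have pos_a i : ~~ (i < e)%N -> (0 < c (inl i))%N.
  by rewrite -aE lt0n; apply: contra => /eqP->; rewrite dvdn0.
have le_min : (minn e f < m.+1)%N by rewrite ltnS geq_min leq_ord.
apply/eqP; rewrite eqn_leq; apply/andP; split.
  apply/bigmax_leqP => d /existsP[g /existsP[h /and3P[/injectiveP injg]]].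
  move=> /injectiveP injh /forallP pgh.
  have ge k : (g k < e)%N && (h k < f)%N.
    rewrite -(abE _ _ (pgh k)) andbb; apply/negPn/negP => nge.
    have := nab _ (h k) (pos_a _ nge); rewrite pgh => H.
    by move: nge; rewrite (abE _ _ (pgh k)) -bE => /H.
  have le_inj k (x : 'I_d -> 'I_k) : injective x -> (d <= k)%N.
    by move/leq_card; rewrite !card_ord.
  have lt_e k : (g k < e)%N by case/andP: (ge k).
  have lt_f k : (h k < f)%N by case/andP: (ge k).
  rewrite leq_min (le_inj _ (fun k => Ordinal (lt_e k))) => [|k k' []]; last first.
    by move/val_inj/injg.
  by rewrite (le_inj _ (fun k => Ordinal (lt_f k))) // => k k' [] /val_inj/injh.
apply: (@leq_bigmax_cond _ (fun d : 'I_m.+1 => matching c d) (fun d => d) (Ordinal le_min)).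
have lm (k : 'I_(minn e f)) : (k < m)%N.
  by rewrite (leq_trans (ltn_ord k)) // geq_min leq_ord.
have ln (k : 'I_(minn e f)) : (k < n)%N.
  by rewrite (leq_trans (ltn_ord k)) // geq_min leq_ord orbT.
apply/existsP; exists [ffun k => Ordinal (lm k)].
apply/existsP; exists [ffun k => Ordinal (ln k)]; apply/and3P; split.
- by apply/injectiveP => k k'; rewrite !ffunE => -[] /val_inj.
- by apply/injectiveP => k k'; rewrite !ffunE => -[] /val_inj.
apply/forallP => k; rewrite !ffunE; have := ltn_ord k; rewrite leq_min => /andP[ke kf].
by rewrite dvdn_add ?aE ?bE.
Qed.

(** * Invariants of a class and uniqueness of canonical tuples *)

(** The two entries of a divisible pair contribute equally to the two counts
    compared by [balance], which makes the difference invariant. *)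
Lemma eqn_mod_pair a b x : (p %| a + b)%N -> (a == x %[mod p])%N = (p %| b + x)%N.
Proof.
move=> pab; rewrite -(eqn_modDr b) /dvdn [(b + x)%N]addnC.
by move: pab; rewrite /dvdn => /eqP->; rewrite eq_sym.
Qed.

(** The number of left entries congruent to x minus the number of right
    entries congruent to -x. *)
Definition balance (x : nat) t : int :=
  \sum_i (t (inl i) == x %[mod p])%N%:Z - \sum_j (p %| t (inr j) + x)%N%:Z.

Lemma balance_equiv x t u : tup_equiv t u -> balance x t = balance x u.
Proof.
apply: tup_equiv_eq => {}t {}u.
  move=> /perm_stepP[s [w ->]]; rewrite /balance; congr (_ - _).
    by rewrite (reindex_inj (@perm_inj _ s)); apply: eq_bigr => i _; rewrite ffunE.
  by rewrite (reindex_inj (@perm_inj _ w)); apply: eq_bigr => i _; rewrite ffunE.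
move=> /shift_stepP[i [j [ptij etu off]]]; rewrite /balance.
have put : (p %| u (inl i) + u (inr j))%N by rewrite -(dvdn_modq etu).
rewrite (bigD1 i) // [X in _ - X](bigD1 j) //= (eqn_mod_pair _ ptij) opprD addrACA subrr.
rewrite [in RHS](bigD1 i) // [X in _ = _ - X](bigD1 j) //= (eqn_mod_pair _ put) opprD addrACA subrr.
congr (_ + (_ - _)); apply: eq_bigr => k nk; rewrite off //.
Qed.

Lemma sum_equiv t u : tup_equiv t u -> (\sum_v t v = \sum_v u v %[mod q])%N.
Proof.
apply: (tup_equiv_eq (F := fun t => (\sum_v t v) %% q)%N) => {}t {}u.
  move=> /perm_stepP[s [w ->]]; rewrite !big_sumType /=; congr ((_ + _) %% _)%N.
    by rewrite (reindex_inj (@perm_inj _ s)); apply: eq_bigr => i _; rewrite ffunE.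
  by rewrite (reindex_inj (@perm_inj _ w)); apply: eq_bigr => i _; rewrite ffunE.
move=> /shift_stepP[i [j [_ etu off]]].
rewrite (bigD1 (inl i)) // (bigD1 (inr j)) //= addnA -modnDml etu modnDml.
rewrite [in RHS](bigD1 (inl i)) // [in RHS](bigD1 (inr j)) //= addnA.
by congr ((_ + _) %% _)%N; apply: eq_bigr => v /andP[? ?]; rewrite off.
Qed.

Lemma canonical_shape c : canonical c ->
  if atypical c then exists (e : 'I_m.+1) (f : 'I_n.+1), canonical_pos c e f /\ (0 < f)%N
  else nondecreasing_ord (fun i => c (inl i)) /\
       nondecreasing_ord (fun j => c (inr j)).
Proof.
rewrite /canonical; have := defect_eq0 c; case: (boolP (atypical c)) => hp /= ->.
  case/existsP => e /existsP[f /andP[/eqP def can]].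
  exists e, f; split=> //; have : defect c != 0%N by rewrite defect_eq0 hp.
  by rewrite def -lt0n leq_min => /andP[].
case/andP => /forallP ma /forallP mb.
by split=> x y lexy; [have /forallP/(_ y) := ma x | have /forallP/(_ y) := mb x];
  rewrite lexy.
Qed.

Lemma balanceE x t : balance x t =
  #|[pred i | t (inl i) == x %[mod p]]|%N%:Z
  - #|[pred j | p %| t (inr j) + x]|%N%:Z.
Proof.
have E (I : finType) (P : pred I) : \sum_i (P i)%:Z = #|P|%:Z.
  rewrite -sum1_card [in RHS]big_mkcond -[RHS]natz natr_sum /=.
  by apply: eq_bigr => i _; rewrite natz unfold_in; case: (P i).
by rewrite /balance !E.
Qed.

(** Entries counted on both sides would form a divisible pair of nonzero
    residues. *)
Lemma canonical_pos_excess c e f x : canonical_pos c e f -> (0 < x < p)%N ->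
  #|[pred i | c (inl i) == x %[mod p]]|%N = 0%N \/
  #|[pred j | p %| c (inr j) + x]|%N = 0%N.
Proof.
move=> can /andP[x_gt0 ltx]; have [_ nab] := canonical_pos_shape can.
have npx : ~~ (p %| x)%N by rewrite gtnNdvd.
have [i /= ci|no] := pickP [pred i | c (inl i) == x %[mod p]]%N; last first.
  by left; apply: eq_card0.
right; apply: eq_card0 => j; rewrite inE; apply/negP => pj.
have pab : (p %| c (inl i) + c (inr j))%N.
  by rewrite /dvdn -modnDml (eqP ci) modnDml addnC.
apply/negP: pab; apply: nab.
  rewrite lt0n; apply: contra npx => /eqP ci0.
  by rewrite /dvdn -(eqP ci) ci0 mod0n.
by apply: contra npx => pcj; rewrite -(dvdn_addr _ pcj).
Qed.

(** Typical classes are orbits of permutations, where sorting is unique.  In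
    an atypical class [balance_equiv] and [canonical_pos_excess] give the
    counts of the nonzero residues on each side, hence all left entries and
    all residues of right entries, and [sum_equiv] gives b_f. *)
Lemma canonical_unique c c' :
  canonical c -> canonical c' -> tup_equiv c c' -> c = c'.
Proof.
move=> /canonical_shape can /canonical_shape can' ecc'.
move: can can'; rewrite -(atypical_equiv ecc').
have [hp|np] := boolP (atypical c); last first.
  have [s [w ->]] := equiv_typical np ecc'.
  move=> [ma mb] [ma' mb']; apply/ffunP => -[i|j]; apply/val_inj => /=.
    apply: (nondecreasing_ord_eq ma ma') => x _; apply/esym.
    by rewrite -[RHS](card_preim_perm s); apply: eq_card => i'; rewrite !inE ffunE.
  apply: (nondecreasing_ord_eq mb mb') => x _; apply/esym.
  by rewrite -[RHS](card_preim_perm w); apply: eq_card => j'; rewrite !inE ffunE.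
move=> [e [f [can f_gt0]]] [e' [f' [can' f'_gt0]]].
have [[lta ma bf mb ltb] nab] := canonical_pos_shape can.
have [[lta' ma' bf' mb' ltb'] nab'] := canonical_pos_shape can'.
have counts x : (0 < x < p)%N ->
  #|[pred i | c (inl i) == x %[mod p]]|%N = #|[pred i | c' (inl i) == x %[mod p]]|%N
  /\ #|[pred j | p %| c (inr j) + x]|%N = #|[pred j | p %| c' (inr j) + x]|%N.
  move=> ltx; have := balance_equiv x ecc'; rewrite !balanceE.
  have := canonical_pos_excess can ltx; have := canonical_pos_excess can' ltx.
  lia.
have ea i : c (inl i) = c' (inl i).
  apply/val_inj/(nondecreasing_ord_eq ma ma') => x x_gt0 {i}.
  have [ltx|lex] := ltnP x p; last first.
    by rewrite !eq_card0 // => i; rewrite !inE ltn_eqF // (leq_trans _ lex).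
  have [E _] := counts x (introT andP (conj x_gt0 ltx)).
  etransitivity; last etransitivity; last 1 first; last exact: E.
    by apply: eq_card => i; rewrite !inE !modn_small.
  by apply: eq_card => i; rewrite !inE !modn_small.
have eb j : (c (inr j) %% p = c' (inr j) %% p)%N.
  apply/(nondecreasing_ord_eq mb mb') => x x_gt0 {j}.
  have [ltx|lex] := ltnP x p; last first.
    by rewrite !eq_card0 // => i; rewrite !inE ltn_eqF // (leq_trans _ lex) // ltn_mod prime_gt0.
  have x'P : (0 < p - x < p)%N by lia.
  have H (a : nat) : (a %% p == x)%N = (p %| a + (p - x))%N.
    rewrite -{1}(modn_small ltx) -(eqn_modDr (p - x)) subnKC ?(ltnW ltx) //.
    by rewrite modnn.
  have [_ E] := counts _ x'P.
  etransitivity; last etransitivity; last 1 first; last exact: E.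
    by apply: eq_card => i; rewrite !inE H.
  by apply: eq_card => i; rewrite !inE H.
(* f is the number of right entries divisible by p. *)
have eff : f = f'.
  have le_f (f1 f2 : 'I_n.+1) : (forall j, (j < f1) = (j < f2))%N -> (f1 <= f2)%N.
    move=> e12; rewrite leqNgt; apply/negP => lt21.
    have ltn2 : (f2 < n)%N by rewrite (leq_trans lt21) ?leq_ord.
    by have := e12 (Ordinal ltn2); rewrite /= lt21 ltnn.
  have e12 j : (j < f)%N = (j < f')%N by rewrite -bf -bf' eb.
  by apply/val_inj/anti_leq; rewrite !le_f.
have ecj j : j.+1 != f -> c (inr j) = c' (inr j).
  move=> njf; apply/val_inj => /=; have := eb j; rewrite !modn_small //.
    by apply: ltb'; rewrite -eff.
  exact: ltb.
apply/ffunP => -[i|j]; first exact: ea.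
have [ejf|njf] := eqVneq j.+1 f; last exact: ecj.
apply/val_inj; have := sum_equiv ecc'; rewrite !big_sumType /=.
rewrite (eq_bigr _ (fun i _ => congr1 val (ea i))) => /eqP; rewrite eqn_modDl.
rewrite (bigD1 j) // [X in _ == X %[mod _]](bigD1 j) //=.
rewrite (eq_bigr (fun k => c' (inr k) : nat)) => [|k nkj]; last first.
  by rewrite ecj // -ejf eqSS.
by rewrite eqn_modDr !modn_small // => /eqP.
Qed.

(** * Existence of canonical tuples *)

Lemma residuesE z v : residues z v = (z v %% q)%N :> nat.
Proof. by rewrite ffunE. Qed.

Definition set_pair z i j (a b : nat) : var -> nat := fun v =>
  if v == inl i then a else if v == inr j then b else z v.

(** The moves of the existence proof are composed on families of natural
    numbers, so that residues modulo q are taken once, at the end. *)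
Lemma set_pair_equiv i j z a b :
  (p %| z (inl i) + z (inr j))%N ->
  z (inl i) + z (inr j) = a + b %[mod q] ->
  tup_equiv (residues z) (residues (set_pair z i j a b)).
Proof.
move=> pij ez; apply: (tup_equiv_shift (i := i) (j := j)).
- by rewrite !residuesE (dvdn_modq (modnDm _ _ _)).
- by rewrite !residuesE !modnDm /set_pair !eqxx.
- move=> v nvi nvj; apply/val_inj; rewrite /= !residuesE /set_pair.
  by rewrite (negPf nvi) (negPf nvj).
Qed.

(** With hub (i0, j0) at (0, b) and c the entry at i of residue x, three moves
    at (i0, j0), (i, j0) and (i0, j0) again lead the values at i0, i, j0
    through (0, c, b) ~ (x, c, b - x) ~ (x, x, b + c - 2x) ~ (0, x, b + c - x).
    The terms q - x below stand for -x. *)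
Lemma reduce_left_entry t i0 j0 i : t (inl i0) = 0%N :> nat -> (p %| t (inr j0))%N ->
  i != i0 -> exists u, [/\ tup_equiv t u, u (inl i) = (t (inl i) %% p)%N :> nat,
    (p %| u (inr j0))%N &
    forall v, v != inl i -> v != inr j0 -> u v = t v].
Proof.
move=> t0 pj0 nii0.
have arith (b q' c x : nat) :
    (x <= c -> x <= q' -> c + (b + (q' - x)) = b + q' + (c - x))%N.
  by clear; lia.
set c := (t (inl i) : nat); set x := (c %% p)%N; set b := (t (inr j0) : nat).
have ltx : (x < p)%N by rewrite ltn_mod prime_gt0.
have lex : (x <= c)%N by rewrite leq_mod.
have pq : (p %| q)%N by rewrite dvdn_exp.
have lexq : (x <= q)%N := leq_trans (ltnW ltx) leq_prime_modulus.
have pcx : (p %| c - x)%N by rewrite /x {1}(divn_eq c p) addnK dvdn_mull.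
have pbq : (p %| b + q)%N by rewrite dvdn_add.
pose z0 v := (t v : nat).
pose z1 := set_pair z0 i0 j0 x (b + (q - x)).
pose z2 := set_pair z1 i j0 x (b + (q - x) + (c - x)).
pose z3 := set_pair z2 i0 j0 0 (b + q + (c - x)).
have E1 : tup_equiv (residues z0) (residues z1).
  apply: set_pair_equiv; rewrite /z0 t0 ?add0n //.
  by rewrite addnCA subnKC // modnDr.
have E2 : tup_equiv (residues z1) (residues z2).
  have z1i : z1 (inl i) = c by rewrite /z1 /set_pair; case: eqP => // -[/eqP]; rewrite (negPf nii0).
  have z1j : z1 (inr j0) = (b + (q - x))%N by rewrite /z1 /set_pair eqxx.
  apply: set_pair_equiv; rewrite z1i z1j.
    by rewrite arith // dvdn_add.
  by rewrite [in RHS]addnCA subnKC // addnC.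
have E3 : tup_equiv (residues z2) (residues z3).
  have z2i : z2 (inl i0) = x.
    by rewrite /z2 /z1 /set_pair eqxx; case: eqP.
  have z2j : z2 (inr j0) = (b + (q - x) + (c - x))%N by rewrite /z2 /set_pair eqxx.
  apply: set_pair_equiv; rewrite z2i z2j.
    by rewrite addnA addnCA subnKC // dvdn_add.
  by rewrite add0n addnA addnCA subnKC.
exists (residues z3); split.
- by rewrite -{1}[t]residues_tup; exact: (tup_equiv_trans (tup_equiv_trans E1 E2) E3).
- rewrite residuesE /z3 /z2 /set_pair eqxx; case: eqP => [[/eqP]|_].
    by rewrite (negPf nii0).
  by rewrite modn_small // (leq_trans ltx) // leq_prime_modulus.
- rewrite residuesE (dvdn_modq (modn_mod _ _)) /z3 /set_pair !eqxx /=.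
  exact: dvdn_add.
- move=> v nvi nvj; apply/val_inj; rewrite /= residuesE /z3 /z2 /z1 /z0 /set_pair /=.
  rewrite (negPf nvi) (negPf nvj).
  by case: eqP => [->|_]; rewrite ?mod0n ?t0 // modn_small.
Qed.

(** The analogue of [reduce_left_entry] for a right entry c of residue y: the
    moves at (i0, j0), (i0, j) and (i0, j0) lead the values at i0, j, j0
    through (0, c, b) ~ (p - y, c, b - (p - y)) ~
    (p - y + c - y, y, b - (p - y)) ~ (0, y, b + c - y). *)
Lemma reduce_right_entry t i0 j0 j : t (inl i0) = 0%N :> nat -> (p %| t (inr j0))%N ->
  j != j0 -> exists u, [/\ tup_equiv t u, u (inr j) = (t (inr j) %% p)%N :> nat,
    (p %| u (inr j0))%N &
    forall v, v != inr j -> v != inr j0 -> u v = t v].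
Proof.
move=> t0 pj0 njj0; set c := (t (inr j) : nat); set y := (c %% p)%N; set b := (t (inr j0) : nat).
have lty : (y < p)%N by rewrite ltn_mod prime_gt0.
have ley : (y <= c)%N by rewrite leq_mod.
have pq : (p %| q)%N by rewrite dvdn_exp.
have lexq : (p - y <= q)%N := leq_trans (leq_subr _ _) leq_prime_modulus.
have pcy : (p %| c - y)%N by rewrite /y {1}(divn_eq c p) addnK dvdn_mull.
have pbq : (p %| b + q)%N by rewrite dvdn_add.
pose z0 v := (t v : nat).
pose z1 := set_pair z0 i0 j0 (p - y) (b + (q - (p - y))).
pose z2 := set_pair z1 i0 j (p - y + (c - y)) y.
pose z3 := set_pair z2 i0 j0 0 (b + q + (c - y)).
have E1 : tup_equiv (residues z0) (residues z1).
  apply: set_pair_equiv; rewrite /z0 t0 ?add0n //.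
  by rewrite addnCA subnKC // modnDr.
have E2 : tup_equiv (residues z1) (residues z2).
  have z1i : z1 (inl i0) = (p - y)%N by rewrite /z1 /set_pair eqxx.
  have z1j : z1 (inr j) = c.
    by rewrite /z1 /set_pair /=; case: eqP => // -[/eqP]; rewrite (negPf njj0).
  apply: set_pair_equiv; rewrite z1i z1j.
    by rewrite addnC addnBA ?(ltnW lty) // addnC -addnBA // dvdn_add.
  by rewrite -addnA subnK.
have E3 : tup_equiv (residues z2) (residues z3).
  have z2i : z2 (inl i0) = (p - y + (c - y))%N by rewrite /z2 /set_pair eqxx.
  have z2j : z2 (inr j0) = (b + (q - (p - y)))%N.
    by rewrite /z2 /z1 /set_pair /= eqxx; case: eqP => // -[/eqP]; rewrite eq_sym (negPf njj0).
  apply: set_pair_equiv; rewrite z2i z2j.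
    by rewrite addnAC addnCA subnKC // dvdn_add.
  by rewrite addnAC addnCA subnKC.
exists (residues z3); split.
- by rewrite -{1}[t]residues_tup; exact: (tup_equiv_trans (tup_equiv_trans E1 E2) E3).
- rewrite residuesE /z3 /z2 /set_pair /= eqxx; case: eqP => [[/eqP]|_].
    by rewrite (negPf njj0).
  by rewrite modn_small // (leq_trans lty) // leq_prime_modulus.
- rewrite residuesE (dvdn_modq (modn_mod _ _)) /z3 /set_pair !eqxx /=.
  exact: dvdn_add.
- move=> v nvi nvj; apply/val_inj; rewrite /= residuesE /z3 /z2 /z1 /z0 /set_pair /=.
  rewrite (negPf nvi) (negPf nvj).
  by case: eqP => [->|_]; rewrite ?mod0n ?t0 // modn_small.
Qed.

(** Left entries weigh twice as much as right ones, so that moving a divisible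
    pair (a, b) with a > 0 to (0, a + b) lowers the weight; the hub entry b_j0
    is free to absorb everything. *)
Definition hub_weight j0 t : nat :=
  (\sum_(v | v != inr j0) (if v is inl _ then 2 else 1) * t v)%N.

Lemma hub_weight_lt j0 t u v :
  v != inr j0 -> (forall w, w != inr j0 -> u w <= t w)%N -> (u v < t v)%N ->
  (hub_weight j0 u < hub_weight j0 t)%N.
Proof.
move=> nv leut ltut; rewrite /hub_weight (bigD1 v) // [ltnRHS](bigD1 v) //=.
rewrite -addSn leq_add //; first by rewrite ltn_pmul2l //; case: (v).
by apply: leq_sum => w /andP[nw _]; rewrite leq_mul2l leut ?orbT.
Qed.

(** The representative of least weight among those with a divisible pair at
    (i0, j0): each failing property allows a move that lowers the weight. *)
Lemma exists_reduced t i0 j0 : (p %| t (inl i0) + t (inr j0))%N ->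
  exists u, tup_equiv t u /\
    [/\ u (inl i0) = 0%N :> nat, (p %| u (inr j0))%N,
        forall i, (u (inl i) < p)%N,
        forall j, j != j0 -> (u (inr j) < p)%N &
        forall i j, j != j0 -> (0 < u (inl i))%N -> (0 < u (inr j))%N ->
          ~~ (p %| u (inl i) + u (inr j))%N].
Proof.
move=> pt; pose P u := tup_equiv t u && (p %| u (inl i0) + u (inr j0))%N.
have Pt : P t by rewrite /P pt andbT; apply: connect0.
case: (arg_minnP (hub_weight j0) Pt) => u /andP[etu pu] minu.
have min_u v : tup_equiv u v -> (p %| v (inl i0) + v (inr j0))%N ->
    (hub_weight j0 u <= hub_weight j0 v)%N.
  by move=> euv pv; apply: minu; rewrite /P pv (tup_equiv_trans etu euv).
have u0 : u (inl i0) = 0%N :> nat.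
  apply/eqP; rewrite -leqn0 leqNgt; apply/negP => u_gt0.
  pose z := set_pair (fun v => u v) i0 j0 0 (u (inl i0) + u (inr j0)).
  have zi : residues z (inl i0) = 0%N :> nat by rewrite residuesE /z /set_pair eqxx mod0n.
  have := min_u (residues z); rewrite leqNgt (@hub_weight_lt _ _ _ (inl i0)) //; last first.
  - by rewrite zi.
  - move=> v nv; rewrite residuesE /z /set_pair (negPf nv).
    by case: eqP => _; rewrite ?mod0n // modn_small.
  move=> H; suff: false by []; apply: H.
    by rewrite -{1}[u]residues_tup; apply: set_pair_equiv.
  by rewrite zi add0n residuesE (dvdn_modq (modn_mod _ _)) /z /set_pair eqxx.
have pj0 : (p %| u (inr j0))%N by move: pu; rewrite u0.
have lta i : (u (inl i) < p)%N.
  have [->|nii0] := eqVneq i i0; first by rewrite u0 prime_gt0.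
  rewrite ltnNge; apply/negP => lep.
  have [v [euv vi pvj off]] := reduce_left_entry u0 pj0 nii0.
  have := min_u v euv; rewrite leqNgt (@hub_weight_lt _ _ _ (inl i)) //; last first.
  - by rewrite vi (leq_trans _ lep) // ltn_mod prime_gt0.
  - move=> w nw; have [->|nwi] := eqVneq w (inl i); first by rewrite vi leq_mod.
    by rewrite off.
  move=> H; suff: false by []; apply: H; rewrite off ?u0 // eq_sym.
  by apply: contra nii0 => /eqP[->].
have ltb j : j != j0 -> (u (inr j) < p)%N.
  move=> njj0; rewrite ltnNge; apply/negP => lep.
  have [v [euv vj pvj off]] := reduce_right_entry u0 pj0 njj0.
  have := min_u v euv; rewrite leqNgt (@hub_weight_lt _ _ _ (inr j)) //; last first.
  - by rewrite vj (leq_trans _ lep) // ltn_mod prime_gt0.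
  - move=> w nw; have [->|nwi] := eqVneq w (inr j); first by rewrite vj leq_mod.
    by rewrite off.
  by move=> H; suff: false by []; apply: H; rewrite off ?u0.
exists u; split=> //; split=> // i j njj0 a_gt0 b_gt0; apply/negP => pij.
have njr : inr j != inr j0 :> var by apply: contra njj0 => /eqP[->].
have nii0 : i != i0 by apply: contraL a_gt0 => /eqP->; rewrite u0.
pose z := set_pair (fun v => u v) i j 0 (u (inl i) + u (inr j)).
have off v : v != inl i -> v != inr j -> residues z v = u v.
  move=> nvi nvj; apply/val_inj; rewrite /= residuesE /z /set_pair.
  by rewrite (negPf nvi) (negPf nvj) modn_small.
have nil : inl i != inl i0 :> var by apply: contra nii0 => /eqP[->].
have := min_u (residues z).
rewrite (off (inl i0)) 1?eq_sym // (off (inr j0)) 1?[inr j0 == _]eq_sym //.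
rewrite leqNgt /hub_weight; set w1 := (X in (X < _)%N); set w2 := (X in (_ < X)%N).
have -> : (w1 < w2)%N.
  rewrite /w1 /w2 (bigD1 (inl i)) // (bigD1 (inr j)) ?njr //=.
  rewrite [ltnRHS](bigD1 (inl i)) // [in ltnRHS](bigD1 (inr j)) ?njr //=.
  rewrite !residuesE /z /set_pair !eqxx /= mod0n.
  rewrite (eq_bigr (fun v => (if v is inl _ then 2 else 1) * u v)%N) => [|v]; last first.
    by move=> /andP[/andP[_ nvi] nvj]; rewrite -(off v nvi nvj) residuesE.
  rewrite muln0 add0n addnA ltn_add2r !mul1n (leq_ltn_trans (leq_mod _ _)) //.
  by rewrite ltn_add2r mul2n -addnn -[ltnLHS]addn0 ltn_add2l.
move=> H; suff: false by []; apply: H => //.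
by rewrite -{1}[u]residues_tup; apply: set_pair_equiv.
Qed.

(** In an atypical class only the order of the entries is left to arrange in
    the tuple of [exists_reduced].  The right entries are sorted by a key that
    puts the zeros first, then the hub entry, then the nonzero residues. *)
Lemma canonical_exists t : exists2 c, canonical c & tup_equiv t c.
Proof.
have [hp|np] := boolP (atypical t); last first.
  have [s ma] := exists_sorting (fun i => t (inl i) : nat).
  have [w mb] := exists_sorting (fun j => t (inr j) : nat).
  exists (tup_perm s w t); last exact: tup_equiv_perm.
  rewrite /canonical ifT; last by rewrite defect_eq0 atypical_perm.
  apply/andP; split; apply/forallP => x; apply/forallP => y; apply/implyP => lexy;
    rewrite !ffunE; [exact: ma | exact: mb].
have /atypicalP[i0 [j0 pt]] := hp.
have [u [etu [u0 pj0 lta ltb nab]]] := exists_reduced pt.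
have [s ma] := exists_sorting (fun i => u (inl i) : nat).
pose key j := if j == j0 then 1%N else if u (inr j) == 0%N :> nat then 0%N else (u (inr j)).+1.
have [w mk] := exists_sorting key.
have key_le1 j : (key j <= 1)%N = (p %| u (inr j))%N.
  rewrite /key; have [->|nj] := eqVneq j j0; first by rewrite pj0.
  case: eqP => [->|/eqP nz]; first by rewrite dvdn0.
  by rewrite ltnS leqn0 (negPf nz) gtnNdvd ?lt0n // ltb.
have key1 j : key j = 1%N -> j = j0.
  rewrite /key; have [//|nj] := eqVneq j j0.
  by case: eqP => // nz [] /nz.
have key_gt1 j : (1 < key j)%N ->
    [/\ j != j0, key j = (u (inr j)).+1 & (0 < u (inr j))%N].
  rewrite /key; have [//|nj] := eqVneq j j0.
  by case: eqP => // /eqP; rewrite -lt0n.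
have [e eP] : exists e : 'I_m.+1, forall i,
    (u (inl (s i)) == 0 :> nat)%N = (i < e)%N.
  by apply: exists_threshold => i i' /ma; rewrite -!leqn0; apply: leq_trans.
have [f fP] : exists f : 'I_n.+1, forall j, (key (w j) <= 1)%N = (j < f)%N.
  by apply: exists_threshold => j j' /mk; apply: leq_trans.
pose c := tup_perm s w u.
have ca i : c (inl i) = u (inl (s i)) by rewrite ffunE.
have cb j : c (inr j) = u (inr (w j)) by rewrite ffunE.
(* From position f on, the keys exceed 1 and are successors of entries. *)
have gtf j : (f < j.+1)%N -> (1 < key (w j))%N by rewrite ltnS leqNgt -fP -ltnNge.
have etc : tup_equiv t c := tup_equiv_trans etu (tup_equiv_perm s w u).
have can : canonical_pos c e f.
  apply/and5P; split; last apply/and4P; try split.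
  - by apply/forallP => i; apply/implyP; rewrite -eP ca.
  - apply/forallP => i; apply/implyP; rewrite ltnS leqNgt -eP ca => nz.
    by rewrite lt0n nz lta.
  - apply/forallP => i; apply/forallP => i'; apply/implyP => _; apply/implyP.
    by rewrite !ca; apply: ma.
  - apply/forallP => j; apply/implyP => ltjf; rewrite cb.
    have ltjn : (j.+1 < n)%N by rewrite (leq_trans ltjf) ?leq_ord.
    have := fP (Ordinal ltjn); rewrite /= ltjf => key_j1.
    have lekey := mk j (Ordinal ltjn) (leqnSn j).
    (* The hub alone has key 1, so no other key at most 1 can follow it. *)
    have nj : w j != j0.
      apply/eqP => wj; have kj : key (w j) = 1%N by rewrite /key wj eqxx.
      have /key1 : key (w (Ordinal ltjn)) = 1%N.
        by apply/eqP; rewrite eqn_leq key_j1 -kj.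
      by rewrite -wj => /perm_inj/(congr1 val)/= /eqP; rewrite gtn_eqF.
    have := leq_trans lekey key_j1; rewrite /key (negPf nj).
    by case: eqP => // /eqP nz; rewrite ltnS leqn0 (negPf nz).
  - apply/forallP => j; apply/implyP => /eqP ejf.
    by rewrite cb -key_le1 fP -ejf.
  - apply/forallP => j; apply/implyP => /gtf/key_gt1[nj _ b_gt0].
    by rewrite cb b_gt0 ltb.
  - apply/forallP => j; apply/forallP => j'; apply/implyP => ltfj.
    apply/implyP => lej; rewrite !cb -ltnS.
    have [_ <- _] := key_gt1 _ (gtf _ ltfj).
    by have [_ <- _] := key_gt1 _ (gtf j' (leq_trans ltfj (lej : (j < j'.+1)%N))); apply: mk.
  - apply/forallP => i; apply/forallP => j; apply/implyP.
    rewrite ltnS leqNgt -eP -lt0n => a_gt0.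
    apply/implyP => /gtf/key_gt1[nj _ b_gt0].
    by rewrite ca cb; apply: nab.
exists c => //; rewrite /canonical defect_eq0 -(atypical_equiv etc) hp /=.
apply/existsP; exists e; apply/existsP; exists f.
by rewrite (defect_canonical_pos can) eqxx.
Qed.

End Classes.

(** * Values of elements of Dist(T) *)

Section Values.
Variables (R : comNzRingType) (V : finType).
Implicit Types (f : dist R V) (z : V -> nat).

Lemma eq_dev f z z' : z =1 z' -> dev f z = dev f z'.
Proof.
by move=> ez; apply: eq_bigr => t _; congr (_ * _%:R); apply: eq_bigr => v _;
  rewrite ez.
Qed.

Lemma devB f g z : dev (f - g) z = dev f z - dev g z.
Proof. by rewrite -scaleN1r devD devZ mulN1r. Qed.

Lemma dev_dbin v a z : dev (dbin R v a) z = 'C(z v, a)%:R.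
Proof.
rewrite devU mul1r (bigD1 v) //= ffunE eqxx big1 ?muln1 // => w /negPf nwv.
by rewrite ffunE nwv bin0.
Qed.

Lemma dev_prod (I : Type) (s : seq I) (P : pred I) (F : I -> dist R V) z :
  dev (\prod_(i <- s | P i) F i) z = \prod_(i <- s | P i) dev (F i) z.
Proof. by apply: (big_morph (fun f => dev f z)) => [f g|]; rewrite ?devM ?dev1. Qed.

Lemma dev_dlin (F : {ffun V -> nat} -> dist R V) f z :
  dev (dlin F f) z = \sum_(t <- msupp f) f@_t * dev (F t) z.
Proof. by rewrite dev_sum; apply: eq_bigr => t _; rewrite devZ. Qed.

(** At z v = 0 the left-hand side would be the value of binom(x, a) at -1,
    which periodicity later trades for the value at q - 1. *)
Lemma dev_dbin_pred v a z : (0 < z v)%N ->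
  dev (dbin_pred R v a) z = 'C((z v).-1, a)%:R.
Proof.
case zv: (z v) => [//|k] _ /=; rewrite dev_sum.
under eq_bigr => i _ do rewrite devZ dev_dbin zv.
elim: a => [|a IH]; first by rewrite big_ord1 !bin0 mul1r.
rewrite big_ord_recr /= subnn mul1r binS natrD -IH.
rewrite (eq_bigr (fun i : 'I_a.+1 => - ((-1) ^+ (a - i) * 'C(k.+1, i)%:R))).
  by rewrite sumrN addrC addrK.
by move=> i _; rewrite subSn -1?ltnS // exprS mulN1r mulNr.
Qed.

Lemma dev_dbin_succ v a z : dev (dbin_succ R v a) z = 'C((z v).+1, a)%:R.
Proof.
rewrite /dbin_succ; case: a => [|a]; first by rewrite addr0 dev_dbin !bin0.
by rewrite devD !dev_dbin binS natrD.
Qed.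

Lemma dev_mul_addvar v w f z :
  dev ((dbin R v 1 + dbin R w 1) * f) z = (z v + z w)%:R * dev f z.
Proof. by rewrite devM devD !dev_dbin !bin1 natrD. Qed.

End Values.

(** * Dist(T_r) as an algebra of functions *)

Section Torus.
Variables (K : fieldType) (p r m n : nat).
Hypotheses (pK : p \in [pchar K]) (r_gt0 : (0 < r)%N).
Local Notation var := ('I_m + 'I_n)%type.
Local Notation D := (dist K var).
Local Notation q := (p ^ r)%N.
Local Notation tup := (tup p r m n).
Implicit Types (f g : D) (i : 'I_m) (j : 'I_n) (t u c : tup) (z : var -> nat).

Let p_pr : prime p := pcharf_prime pK.
Let q_gt0 : (0 < q)%N := modulus_gt0 r p_pr.
Local Notation residues := (@residues p r m n p_pr).

(** Tuples are the points of (Z/q)^(m+n), with representatives in [0, q). *)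
Definition value f t : K := dev f (fun v => t v).

Lemma dev_XY v (a : 'I_q) z : dev (XY K p r v a) z = (z v %% q == a)%N%:R.
Proof.
rewrite dev_sum -(bin_inversion (r := r) pK) ?ltn_pmod //.
apply: eq_big_nat => k /andP[_ ltk].
by rewrite devZ dev_dbin (bin_modq pK).
Qed.

Lemma helE t : hel K t = \prod_v XY K p r v (t v).
Proof. by rewrite big_sumType. Qed.

(* Conversion between two indicators would otherwise expand their products. *)
#[local] Opaque hel.

Lemma dev_hel t z : dev (hel K t) z = (residues z == t)%:R.
Proof.
rewrite helE dev_prod; under eq_bigr => v _ do rewrite dev_XY.
have [<-|ne] := eqVneq (residues z) t.
  by rewrite big1 // => v _; rewrite ffunE eqxx.
have [v nv] : exists v, residues z v != t v.
  apply/existsP; rewrite -negb_forall; apply: contra ne => /forallP E.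
  by apply/eqP/ffunP => v; exact/eqP.
rewrite (bigD1 v) //=; suff -> : (z v %% q == t v)%N = false by rewrite mul0r.
by apply/negbTE; apply: contra nv => /eqP E; apply/eqP/val_inj; rewrite ffunE.
Qed.

Lemma value_hel t u : value (hel K t) u = (u == t)%:R.
Proof. by rewrite /value dev_hel residues_tup. Qed.

Lemma hel_inj : injective (@hel K p r m n).
Proof.
move=> t u etu; have := value_hel t u; rewrite etu value_hel eqxx => {etu}.
by case: eqP => // _ /eqP; rewrite oner_eq0.
Qed.

Lemma distTr_lin (a : K) f g : distTr p r f -> distTr p r g -> distTr p r (a *: f + g).
Proof.
move=> Tf Tg t /(fsubsetP (msuppD_le _ _)); rewrite in_fsetU => /orP[|/Tg//].
by move=> /(fsubsetP (msuppZ_le _ _))/Tf.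
Qed.

Lemma distTr_sum (I : Type) (s : seq I) (P : pred I) (w : I -> K) (F : I -> D) :
  (forall k, P k -> distTr p r (F k)) -> distTr p r (\sum_(k <- s | P k) w k *: F k).
Proof.
move=> TF; elim/big_rec: _ => [t|k f Pk Tf]; first by rewrite msupp0 inE.
exact/distTr_lin/Tf/TF.
Qed.

Lemma distTr_hel t : distTr p r (hel K t).
Proof.
have XYE v (a : 'I_q) : XY K p r v a =
    \sum_(k < q) ((-1) ^+ (k - a) * 'C(k, a)%:R) *: dbin K v k.
  rewrite -(big_mkord xpredT (fun k => ((-1) ^+ (k - a) * 'C(k, a)%:R) *: dbin K v k)).
  rewrite (big_cat_nat (n := a)) ?(ltnW (ltn_ord a)) //= big_nat big1 ?add0r //.
  by move=> k /andP[_ ltka]; rewrite bin_small // mulr0 scale0r.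
rewrite helE; under eq_bigr => v _ do rewrite XYE.
rewrite bigA_distr_bigA /=; under eq_bigr => k _ do rewrite scaler_prod.
apply: distTr_sum => k _ s.
have -> : \prod_v dbin K v (k v) = << [ffun v => k v : nat] >> :> D.
  by rewrite dbasisE; apply: eq_bigr => v _; rewrite ffunE.
by move=> /(fsubsetP msuppU_le); rewrite in_fset1 => /eqP-> v; rewrite ffunE.
Qed.

Lemma distTr_periodic f : distTr p r f -> forall z, dev f z = value f (residues z).
Proof.
move=> Tf z; apply: eq_big_seq => t /Tf ltt; congr (_ * _).
by rewrite !natr_prod; apply: eq_bigr => v _; rewrite ffunE /= (bin_modq pK).
Qed.

Definition interpolate (F : tup -> K) : D := \sum_t F t *: hel K t.

Lemma distTr_interpolate F : distTr p r (interpolate F).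
Proof. by apply: distTr_sum => t _; apply: distTr_hel. Qed.

Lemma dev_interpolate F z : dev (interpolate F) z = F (residues z).
Proof.
rewrite dev_sum; under eq_bigr => t _ do rewrite devZ dev_hel.
rewrite (bigD1 (residues z)) //= eqxx mulr1 big1 ?addr0 // => t ne.
by rewrite eq_sym (negPf ne) mulr0.
Qed.

(** A periodic element has the same values as the interpolation of its values
    at the tuples, which lies in Dist(T_r) by construction. *)
Lemma distTrP f : distTr p r f <-> forall z, dev f z = value f (residues z).
Proof.
split=> [|ef]; first exact: distTr_periodic.
suff -> : f = interpolate (value f) by apply: distTr_interpolate.
by apply: dev_inj => z; rewrite dev_interpolate.
Qed.

Lemma distTr_inj f g : distTr p r f -> distTr p r g -> value f =1 value g -> f = g.
Proof.
by move=> Tf Tg efg; apply: dev_inj => z; rewrite !distTr_periodic ?efg.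
Qed.

(** A product may involve monomials of degree q or more in a variable; that
    they cancel is seen on periodicity rather than on the structure
    constants. *)
Lemma distTr_mul f g : distTr p r f -> distTr p r g -> distTr p r (f * g).
Proof.
move=> Tf Tg; apply/distTrP => z.
by rewrite /value !devM !distTr_periodic // -!/(value _ _) residues_tup.
Qed.

Lemma dev_perm_subst s w f z :
  dev (perm_subst s w f) z = dev f (fun v => z (perm_var s w v)).
Proof.
rewrite dev_dlin; apply: eq_bigr => t _; congr (_ * _).
by rewrite dev_prod natr_prod; apply: eq_bigr => v _; rewrite dev_dbin.
Qed.

Definition move_unit i j z : var -> nat := fun v =>
  if v == inl i then (z v).-1 else if v == inr j then (z v).+1 else z v.

Lemma dev_shift i j f z : (0 < z (inl i))%N ->
  dev (shift i j f) z = dev f (move_unit i j z).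
Proof.
move=> zi; rewrite dev_dlin; apply: eq_bigr => t _; congr (_ * _).
rewrite dev_prod natr_prod; apply: eq_bigr => v _; rewrite /move_unit.
case: eqP => [->|_]; first by rewrite dev_dbin_pred.
by case: eqP => _; rewrite ?dev_dbin_succ ?dev_dbin.
Qed.

(** The substitutions do not raise the degree in any variable. *)
Lemma distTr_shift i j f : distTr p r f -> distTr p r (shift i j f).
Proof.
move=> Tf; apply/distTrP => z; rewrite /value !dev_dlin.
apply: eq_big_seq => t /Tf ltt; congr (_ * _); rewrite !dev_prod.
have bz a v : (a < q)%N -> 'C(residues z v, a)%:R = 'C(z v, a)%:R :> K.
  by move=> lta; rewrite ffunE /= (bin_modq pK).
apply: eq_bigr => v _; case: ifP => _; last case: ifP => _.
- rewrite !dev_sum; apply: eq_bigr => k _; rewrite !devZ !dev_dbin bz //.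
  by apply: leq_ltn_trans (ltt v); rewrite -ltnS.
- rewrite /dbin_succ; move: (ltt v); case: (t v) => [|a] lta.
    by rewrite !addr0 !dev_dbin !bin0.
  by rewrite !devD !dev_dbin !bz // ltnW.
- by rewrite !dev_dbin bz.
Qed.

(** With p | a + b, unit moves lead from (a, b) to (0, a + b), where only the
    sum modulo q is visible. *)
Lemma value_shift_invariant f i j t u : distTr p r f ->
    (forall z, (0 < z (inl i))%N -> (p %| z (inl i) + z (inr j))%N ->
      dev f (move_unit i j z) = dev f z) ->
  (p %| t (inl i) + t (inr j))%N ->
  t (inl i) + t (inr j) = u (inl i) + u (inr j) %[mod q] ->
  (forall v, v != inl i -> v != inr j -> u v = t v) ->
  value f t = value f u.
Proof.
move=> Tf fmove ptij etu off.
pose G (a b : nat) := dev f (fun v => if v == inl i then a else if v == inr j then b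
                              else t v).
have G0 a b : (p %| a + b)%N -> G a b = G 0%N (a + b)%N.
  elim: a b => // a IH b pab; rewrite addSnnS -IH; last by rewrite -addSnnS.
  rewrite /G -fmove ?eqxx //=; apply: eq_dev => v; rewrite /move_unit.
  by case: eqP => // _; case: eqP.
have Gu (x : tup) : (forall v, v != inl i -> v != inr j -> x v = t v) ->
    value f x = G (x (inl i)) (x (inr j)).
  move=> offx; apply: eq_dev => v; have [->//|nvi] := eqVneq v (inl i).
  by have [->//|nvj] := eqVneq v (inr j); rewrite offx.
have pquij : (p %| u (inl i) + u (inr j))%N.
  by rewrite -(dvdn_modq r_gt0 etu).
rewrite (Gu t) // (Gu u off) (G0 _ _ ptij) (G0 _ _ pquij).
rewrite /G (distTr_periodic Tf) [RHS](distTr_periodic Tf); congr (value f _).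
apply: eq_residues => v.
by case: eqP => // _; case: eqP.
Qed.

(** * Supersymmetric elements *)

Lemma dev_Phi i j f z : dev (Phi i j f) z = dev f z - dev (shift i j f) z.
Proof. exact: devB. Qed.

(** Being a function on (Z/q)^(m+n), an element of Dist(T_r) is a multiple of
    x_i + y_j as soon as it vanishes where x_i + y_j does. *)
Lemma SSP f : SS p r f <->
  distTr p r f /\ (forall t u, tup_equiv t u -> value f t = value f u).
Proof.
split=> [[Tf symf divf]|[Tf invf]].
  split=> //; apply: tup_equiv_eq => t u.
    move=> /perm_stepP[s [w ->]].
    rewrite /value -[in LHS](symf s w) dev_perm_subst.
    by apply: eq_dev => v; rewrite ffunE.
  move=> /shift_stepP[i [j [ptij etu off]]].
  apply: (value_shift_invariant Tf _ ptij) => // z zi pz.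
  have [f' _ /(congr1 (fun g => dev g z))] := divf i j.
  rewrite [LHS]dev_Phi [RHS]dev_mul_addvar.
  rewrite (eqP (_ : _%:R == 0 :> K)) -?(dvdn_pcharf pK) // mul0r dev_shift //.
  by move/eqP; rewrite subr_eq0 => /eqP.
split=> // [s w|i j].
  apply: dev_inj => z; rewrite dev_perm_subst !(distTr_periodic Tf).
  rewrite [RHS](invf _ _ (tup_equiv_perm s w _)); congr (value f _).
  by apply/ffunP => v; apply/val_inj; rewrite !ffunE.
have TPhi : distTr p r (Phi i j f).
  by rewrite /Phi addrC -scaleN1r; apply: distTr_lin => //; apply: distTr_shift.
pose g t : K := value (Phi i j f) t / (t (inl i) + t (inr j))%:R.
exists (interpolate g); first exact: distTr_interpolate.
apply: dev_inj => z; rewrite [RHS]dev_mul_addvar dev_interpolate.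
rewrite (distTr_periodic TPhi) /g; set t := residues z.
have -> : (z (inl i) + z (inr j))%:R = (t (inl i) + t (inr j))%:R :> K.
  by rewrite !ffunE /= !natrD !(natr_modq pK).
clearbody t.
have [pt|npt] := boolP (p %| t (inl i) + t (inr j))%N; last first.
  by rewrite mulrC divfK // -(dvdn_pcharf pK).
rewrite (eqP (_ : _%:R == 0 :> K)) -?(dvdn_pcharf pK) // mul0r.
(* The representative t_i + q of x_i is positive, so that x_i - 1 evaluates
   at a natural number. *)
pose zt v := (t v + (v == inl i) * q)%N.
have tE : residues zt = t.
  by apply/ffunP => v; apply/val_inj; rewrite ffunE /= /zt addnC modnMDl modn_small.
have zt_gt0 : (0 < zt (inl i))%N by rewrite /zt eqxx mul1n addn_gt0 q_gt0 orbT.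
have -> : value (Phi i j f) t = value f t - dev f (move_unit i j zt).
  rewrite -dev_shift // (distTr_periodic (distTr_shift Tf)) tE.
  exact: dev_Phi.
rewrite (distTr_periodic Tf); apply/eqP; rewrite subr_eq0; apply/eqP/invf.
apply: (tup_equiv_shift pt) => [|v nvi nvj]; last first.
  apply/val_inj; rewrite ffunE /= /move_unit (negPf nvi) (negPf nvj) /zt.
  by rewrite (negPf nvi) addn0 modn_small.
rewrite !ffunE /= modnDm /move_unit eqxx /= eqxx /zt eqxx /= mul1n mul0n addn0.
by rewrite addnS -addSn prednK ?addn_gt0 ?q_gt0 ?orbT // addnAC modnDr.
Qed.

(** * The indicators of the classes *)

Lemma dev_Hel c z : dev (Hel K c) z = (tup_equiv c (residues z))%:R.
Proof.
rewrite dev_sum; under eq_bigr => t _ do rewrite dev_hel.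
rewrite -natr_sum; congr _%:R; rewrite big_mkcond (bigD1 (residues z)) //= eqxx.
rewrite big1 ?addn0 => [|t nt]; first by case: ifP.
by rewrite eq_sym (negPf nt); case: ifP.
Qed.

#[local] Opaque Hel.

Lemma value_Hel c t : value (Hel K c) t = (tup_equiv c t)%:R.
Proof. by rewrite /value dev_Hel residues_tup. Qed.

Lemma distTr_Hel c : distTr p r (Hel K c).
Proof. by apply/distTrP => z; rewrite value_Hel dev_Hel. Qed.

Definition combination (w : tup -> K) : D := \sum_(c | canonical c) w c *: Hel K c.

Lemma distTr_combination w : distTr p r (combination w).
Proof. by apply: distTr_sum => c _; apply: distTr_Hel. Qed.

Lemma value_combination w t c : canonical c -> tup_equiv t c ->
  value (combination w) t = w c.
Proof.
move=> can etc; rewrite /value dev_sum.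
under eq_bigr => u _ do rewrite devZ dev_Hel residues_tup.
rewrite (bigD1 c) //= tup_equiv_sym etc mulr1 big1 ?addr0 // => u /andP[canu nuc].
case: (boolP (tup_equiv u t)) => [eut|_]; last by rewrite mulr0.
have euc := tup_equiv_trans eut etc.
by rewrite (canonical_unique p_pr r_gt0 canu can euc) eqxx in nuc.
Qed.

Lemma SS_combination f : SS p r f <-> exists w, f = combination w.
Proof.
split=> [/SSP[Tf invf]|[w ->]].
  exists (value f); apply: distTr_inj => // [|t]; first exact: distTr_combination.
  have [c can etc] := canonical_exists p_pr r_gt0 t.
  by rewrite (value_combination _ can etc); apply: invf.
apply/SSP; split=> [|t u etu]; first exact: distTr_combination.
have [c can euc] := canonical_exists p_pr r_gt0 u.
by rewrite !(value_combination _ can) // (tup_equiv_trans etu).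
Qed.

Lemma SS_subalg : subalg (@SS K p r m n).
Proof.
split=> [|a f g /SSP[Tf invf] /SSP[Tg invg]|f g /SSP[Tf invf] /SSP[Tg invg]];
  apply/SSP; split=> [|t u etu].
- by apply/distTrP => z; rewrite /value !dev0.
- by rewrite /value !dev0.
- exact: distTr_lin.
- by rewrite /value !devD !devZ -!/(value _ _) (invf _ _ etu) (invg _ _ etu).
- exact: distTr_mul.
- by rewrite /value !devM -!/(value _ _) (invf _ _ etu) (invg _ _ etu).
Qed.

Lemma SS_Hel c : SS p r (Hel K c).
Proof.
apply/SSP; split=> [|t u etu]; first exact: distTr_Hel.
rewrite !value_Hel; congr (nat_of_bool _)%:R.
by apply/idP/idP => ect; apply: tup_equiv_trans ect _ => //; rewrite tup_equiv_sym.
Qed.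

End Torus.

Theorem theorem1 (K : fieldType) (p m n r : nat) (pK : p \in [pchar K])
    (m_gt0 : (0 < m)%N) (n_gt0 : (0 < n)%N) (r_gt0 : (0 < r)%N) :
  [/\ is_basis (@canonical p r m n) (@Hel K p r m n) (@SS K p r m n),
      forall t : tup p r m n, exists! B : dist K ('I_m + 'I_n)%type,
        exists c : tup p r m n,
          [/\ canonical c, B = Hel K c &
              exists2 u : tup p r m n, tup_equiv c u & hel K t = hel K u] &
      minimal_generators
        (fun B : dist K ('I_m + 'I_n)%type =>
           exists2 c : tup p r m n, canonical c & B = Hel K c)
        (@SS K p r m n)].
Proof.
have p_pr := pcharf_prime pK; split.
- split=> [w w0 c can|f]; last exact: SS_combination.
  by rewrite -(value_combination pK r_gt0 w can (connect0 _ c)) /combination w0 /value dev0.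
- move=> t; have [c can etc] := canonical_exists p_pr r_gt0 t.
  exists (Hel K c); split.
    by exists c; split=> //; exists t => //; rewrite tup_equiv_sym.
  move=> _ [c' [can' -> [u ecu /(hel_inj pK) etu]]].
  rewrite -etu in ecu; congr (Hel K _); apply: (canonical_unique p_pr r_gt0) => //.
  by rewrite tup_equiv_sym; apply: (tup_equiv_trans ecu).
- split=> [f|S' S'sub S'gen _ [c can ->]].
    split=> [genf|].
      apply: genf; first exact: SS_subalg.
      by move=> _ [c _ ->]; apply: SS_Hel.
    move=> /(SS_combination pK r_gt0)[w ->] B [B0 BD _] BS.
    rewrite /combination; elim/big_rec: _ => [//|c g can Bg].
    by apply: BD => //; apply: BS; exists c.
  have [_ gen_Hel] := S'gen (Hel K c).
  pose B (f : dist K ('I_m + 'I_n)%type) : Prop := value f c = 0 \/ S' (Hel K c).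
  (* The second disjunct is constant: it lets B contain S' without deciding
     whether S' contains the given H. *)
  have [||/eqP|//] := gen_Hel (SS_Hel pK r_gt0 c) B.
  + split=> [|a x y|x y].
    * by left; rewrite /value dev0.
    * case=> [x0|]; last by right.
      case=> [y0|]; last by right.
      by left; rewrite /value devD devZ -!/(value _ _) x0 y0 mulr0 addr0.
    * case=> [x0|]; last by right.
      by left; rewrite /value devM -!/(value _ _) x0 mul0r.
  + move=> y S'y; have [c' can' ey] := S'sub _ S'y.
    have [ecc|ne] := eqVneq c' c; first by right; rewrite -ecc -ey.
    left; rewrite ey (value_Hel pK).
    case: (boolP (tup_equiv c' c)) => // e.
    by rewrite (canonical_unique p_pr r_gt0 can' can e) eqxx in ne.
  + by rewrite (value_Hel pK) /tup_equiv connect0 oner_eq0.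
Qed.
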